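(* Let $\phi\colon\mathbb Z_+\to\mathbb Z_+$ be given by $\phi(0)=0$ and $\phi(n)=n-1$ for $n\geq1$, let $\mathsf w\colon\mathbb Z_+\to\mathbb C$ be a function, and let $\mu$ be the counting measure on the power set of $\mathbb Z_+$. Assume that the weighted composition operator $C_{\phi,\mathsf w}$ is a bounded operator on $L^2(\mu)=\ell^2(\mathbb Z_+)$ and is a $2$-isometry. Then: (i) the Cauchy dual $C_{\phi,\mathsf w}'$ of $C_{\phi,\mathsf w}$ is subnormal if and only if the sequence $\{h_{\phi^n,\mathsf w'_{[n]}}(0)\}_{n=0}^\infty$ is a Hausdorff moment sequence; (ii) for every $n\in\mathbb Z_+$, $$h_{\phi^n,\mathsf w'_{[n]}}(0)=\frac{|\mathsf w(0)|^{2n}}{\alpha_{\mathsf w}^{2n}}+\sum_{j=0}^{n-1}\frac{|\mathsf w(0)|^{2(n-j-1)}|\mathsf w(1)|^2}{\alpha_{\mathsf w}^{2(n-j)}\big(1+j(|\mathsf w(2)|^2-1)\big)}.$$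
   Context: $\mathbb Z_+=\{0,1,2,\ldots\}$; $\alpha_{\mathsf w}=|\mathsf w(0)|^2+|\mathsf w(1)|^2$. Conventions: $\sum_{j=m}^na_j=0$ and $\prod_{l=m}^na_l=1$ if $m>n$; $0^0=1$. The weighted composition operator $C_{\phi,\mathsf w}$ in $L^2(\mu)$ has domain $\{f\in L^2(\mu)\colon\mathsf w\cdot(f\circ\phi)\in L^2(\mu)\}$ and acts by $C_{\phi,\mathsf w}f=\mathsf w\cdot(f\circ\phi)$. For a selfmap $\psi$ of $\mathbb Z_+$ and $\mathsf u\colon\mathbb Z_+\to\mathbb C$, $h_{\psi,\mathsf u}$ denotes the Radon-Nikodym derivative with respect to $\mu$ of the measure $\sigma\mapsto\int_{\psi^{-1}(\sigma)}|\mathsf u|^2\,d\mu$; as $\mu$ is the counting measure, $h_{\psi,\mathsf u}(k)=\sum_{j\in\psi^{-1}(\{k\})}|\mathsf u(j)|^2$ for $k\in\mathbb Z_+$. $\phi^n$ is the $n$-fold composition of $\phi$ with itself, $\phi^0$ being the identity. A bounded operator $T$ on a complex Hilbert space $\mathcal H$ is a $2$-isometry if $I-2T^*T+T^{*2}T^2=0$; every $2$-isometry satisfies $\|Tf\|\geq\|f\|$ for all $f$. For $T$ bounded from below, the Cauchy dual is $T'=T(T^*T)^{-1}$. $T$ is subnormal if it is the restriction to $\mathcal H$ of a bounded normal operator on a complex Hilbert space $\mathcal K\supseteq\mathcal H$ (isometric embedding). The function $\mathsf w'\colon\mathbb Z_+\to\mathbb C$ is defined by $\mathsf w'=\frac{\mathsf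 w}{h_{\phi,\mathsf w}\circ\phi}$ on $\{\mathsf w\neq0\}$ and $\mathsf w'=0$ on $\{\mathsf w=0\}$ (here $h_{\phi,\mathsf w}>0$ everywhere because $C_{\phi,\mathsf w}$ is bounded from below); explicitly, $\mathsf w'(n)=\mathsf w(n)/\alpha_{\mathsf w}$ for $n=0,1$ and $\mathsf w'(n)=1/\overline{\mathsf w(n)}$ for $n\geq2$. Moreover $\mathsf w'_{[0]}=1$ and $\mathsf w'_{[n]}=\prod_{j=0}^{n-1}\mathsf w'\circ\phi^j$ for $n\geq1$. A sequence $\{\gamma_n\}_{n=0}^\infty$ of real numbers is a Hausdorff moment sequence if there is a positive Borel measure $\nu$ on $[0,1]$ with $\gamma_n=\int t^n\,d\nu(t)$ for all $n\in\mathbb Z_+$. *)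

(* Defs.v *)
From HB Require Import structures.
From mathcomp Require Import all_boot all_order all_algebra.
From mathcomp Require Import complex.
From mathcomp Require Import all_classical all_reals all_analysis.
From mathcomp Require Import ring lra.

Set Implicit Arguments.
Unset Strict Implicit.
Unset Printing Implicit Defensive.

Import Order.TTheory GRing.Theory Num.Theory.
Import numFieldNormedType.Exports.

Local Open Scope classical_set_scope.
Local Open Scope ring_scope.

Section DotNorm.
Variables (C : numClosedFieldType) (U : lmodType C).
Variable form : {dot U for @Num.conj C}.

Lemma dot_CauchySchwarz (u v : U) :
  `|form u v| ^+ 2 <= form u u * form v v.
Proof.
have [->|v0] := eqVneq v 0.
  by rewrite !linear0r normr0 expr0n/=; rewrite ?linear0r ?mulr0.
have vv : 0 < form v v by rewrite dnorm_gt0.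
have vvC : (form v v)^* = form v v by apply/CrealP; rewrite ger0_real// ltW.
have := dnorm_ge0 form (form v v *: u - form u v *: v).
set a := form u u; set b := form v v; set d := form u v.
have -> : form (b *: u - d *: v) (b *: u - d *: v) = b * (a * b - `|d| ^+ 2).
  rewrite dnormB (dnormZ form b u) (dnormZ form d v).
  rewrite (linearZl_LR form (d *: v) b u) (linearZr_LR form u d v) /=.
  rewrite !rmorphM /= conjCK -/d vvC -/a -/b !normCK vvC; ring.
by rewrite pmulr_rge0// subr_ge0.
Qed.

Lemma dot_triangle (u v : U) :
  sqrtC (form (u + v) (u + v)) <= sqrtC (form u u) + sqrtC (form v v).
Proof.
rewrite -ler_sqr ?nnegrE ?addr_ge0 ?sqrtC_ge0 ?dnorm_ge0//.
rewrite sqrrD !sqrtCK [leRHS]addrAC dnormD lerD2l.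
rewrite -mulr_natr -[_ + _](divfK (negbT (pnatr_eq0 C 2))).
rewrite ler_pM2r ?ltr0n//.
have [h _] := leif_Re_Creal (form u v).
rewrite ReE in h; apply: (le_trans h) => {h}.
rewrite -(sqrCK (normr_ge0 _)) -sqrtCM ?nnegrE ?dnorm_ge0//.
by rewrite ler_sqrtC ?dot_CauchySchwarz// ?nnegrE ?exprn_ge0 ?mulr_ge0 ?dnorm_ge0.
Qed.
End DotNorm.

(* Every subset of nat is measurable and the counting measure has no nonempty
   null set, so L^2(counting) is a space of functions rather than of classes. *)
Section L2.
Variable R : realType.
Implicit Types (f g : nat -> R[i]) (a b z : R[i]).
Local Notation mu := (@counting nat R).

Definition sqmod z : R := Normc.normc z ^+ 2.

Lemma sqmodE z : sqmod z = complex.Re z ^+ 2 + complex.Im z ^+ 2.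
Proof. by case: z => x y; rewrite /sqmod /= sqr_sqrtr// addr_ge0 ?sqr_ge0. Qed.

Lemma sqmod_ge0 z : 0 <= sqmod z. Proof. exact: sqr_ge0. Qed.

Lemma sqmod0 : sqmod 0 = 0.
Proof. by rewrite /sqmod Normc.normc0 expr0n. Qed.

Lemma sqmodC z : (sqmod z)%:C%C = `|z| ^+ 2.
Proof. by rewrite /sqmod rmorphXn. Qed.

Lemma sqmodM z1 z2 : sqmod (z1 * z2) = sqmod z1 * sqmod z2.
Proof. by rewrite /sqmod Normc.normcM exprMn. Qed.

Lemma sqmodD z1 z2 : sqmod (z1 + z2) <= 2 * sqmod z1 + 2 * sqmod z2.
Proof.
case: z1 z2 => [a b] [c d]; rewrite !sqmodE /= -subr_ge0.
rewrite (_ : _ - _ = (a - c) ^+ 2 + (b - d) ^+ 2); last by ring.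
by rewrite addr_ge0 ?sqr_ge0.
Qed.

Lemma conjCE z : (z^*)%R = conjc z :> R[i].
Proof.
have [->|z0] := eqVneq z 0; first by rewrite !rmorph0.
by apply: (mulfI z0); rewrite -normCK sqr_normc.
Qed.

Definition square_integrable f : Prop :=
  (\int[mu]_n (sqmod (f n))%:E < +oo)%E.

Lemma intmuE (F : nat -> R) : (forall n, 0 <= F n) ->
  (\int[mu]_n (F n)%:E = \sum_(n <oo) (F n)%:E)%E.
Proof. by move=> F0; apply: ge0_integral_count => n; rewrite lee_fin. Qed.

Definition l2_pred : {pred nat -> R[i]} := mem [set f | square_integrable f].

Lemma l2_predE f : (f \in l2_pred) <-> square_integrable f.
Proof. by split => [/set_mem|/mem_set]. Qed.

Lemma l2_pred_submod_closed : submod_closed l2_pred.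
Proof.
split.
  apply/l2_predE; rewrite /square_integrable.
  by rewrite (eq_integral (cst 0%E)) ?integral0// => n _; rewrite [sqmod _]sqmod0.
move=> a u v /l2_predE u2 /l2_predE v2; apply/l2_predE.
rewrite /square_integrable.
have a0 : 0 <= 2 * sqmod a by rewrite mulr_ge0// sqmod_ge0.
apply: (@le_lt_trans _ _ (\int[mu]_n ((2 * sqmod a)%:E * (sqmod (u n))%:E + 2%:E * (sqmod (v n))%:E))%E).
  apply: ge0_le_integral => //=.

  - by move=> x _; rewrite lee_fin sqmod_ge0.
  - move=> x _; rewrite -!EFinM -EFinD lee_fin; apply: le_trans (sqmodD _ _) _.
    by rewrite sqmodM mulrA.
rewrite ge0_integralD//=.
- rewrite ge0_integralZl//=; last by move=> n _; rewrite lee_fin sqmod_ge0.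
  rewrite ge0_integralZl//=; last by move=> n _; rewrite lee_fin sqmod_ge0.
  by apply: lte_add_pinfty; apply: lte_mul_pinfty; rewrite ?lee_fin ?a0.
- by move=> x _; rewrite mule_ge0// lee_fin ?a0 ?sqmod_ge0.
- by move=> x _; rewrite mule_ge0// lee_fin ?a0 ?sqmod_ge0.
Qed.

HB.instance Definition _ :=
  GRing.isSubmodClosed.Build _ _ l2_pred l2_pred_submod_closed.

Record l2 := L2 { l2fun :> nat -> R[i]; _ : l2fun \in l2_pred }.
HB.instance Definition _ := [isSub for l2fun].
HB.instance Definition _ := [Choice of l2 by <:].
HB.instance Definition _ := [SubChoice_isSubLmodule of l2 by <:].

Lemma l2P (f : l2) : square_integrable f.
Proof. by apply/l2_predE; case: f. Qed.

Lemma l2_eq (f g : l2) : (forall n, f n = g n) -> f = g.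
Proof. by move=> fg; apply/val_inj/funext. Qed.

Lemma l2D (f g : l2) n : (f + g : l2) n = f n + g n. Proof. by []. Qed.
Lemma l2N (f : l2) n : (- f : l2) n = - f n. Proof. by []. Qed.
Lemma l2B (f g : l2) n : (f - g : l2) n = f n - g n. Proof. by []. Qed.
Lemma l2Z a (f : l2) n : (a *: f : l2) n = a * f n. Proof. by []. Qed.
Lemma l20 n : (0 : l2) n = 0. Proof. by []. Qed.
End L2.

Section L2dot.
Variable R : realType.
Local Notation mu := (@counting nat R).
Local Notation l2 := (l2 R).
Implicit Types (f g h : l2).

(* Lebesgue integral of a complex function, by real and imaginary parts *)
Definition cintegral (F : nat -> R[i]) : R[i] :=
  Complex (\int[mu]_n complex.Re (F n)) (\int[mu]_n complex.Im (F n)).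

Definition l2dot f g : R[i] := cintegral (fun n => f n * (g n)^*).

Lemma l2_sqmod_integrable f :
  mu.-integrable setT (EFin \o (fun n => sqmod (f n))).
Proof.
apply/integrableP; split=> //=.
under eq_integral do rewrite ger0_norm ?sqmod_ge0//.
exact: l2P.
Qed.

Lemma l2_dom_integrable f g (x : nat -> R) :
  (forall n, `|x n| <= sqmod (f n) + sqmod (g n)) ->
  mu.-integrable setT (EFin \o x).
Proof.
move=> xfg; apply: (@le_integrable _ _ _ _ _ _ _
  (EFin \o (fun n => sqmod (f n) + sqmod (g n)))) => //.
  move=> n _; rewrite /= lee_fin; apply: le_trans (xfg n) _; exact: ler_norm.
rewrite (_ : _ \o _ = (EFin \o (fun n => sqmod (f n))) \+
  (EFin \o (fun n => sqmod (g n)))); last by [].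
by apply: integrableD => //; exact: l2_sqmod_integrable.
Qed.

Lemma normM_dom (a b c d : R) : `|a * c + b * d| <= (a ^+ 2 + b ^+ 2) + (c ^+ 2 + d ^+ 2).
Proof.
rewrite ler_norml; apply/andP; split; rewrite -subr_ge0.
  rewrite (_ : _ - _ = ((a + c) ^+ 2 + (b + d) ^+ 2 + a ^+ 2 + b ^+ 2 + c ^+ 2 + d ^+ 2) / 2); last by field.
  by rewrite divr_ge0// !addr_ge0 ?sqr_ge0.
rewrite (_ : _ - _ = ((a - c) ^+ 2 + (b - d) ^+ 2 + a ^+ 2 + b ^+ 2 + c ^+ 2 + d ^+ 2) / 2); last by field.
by rewrite divr_ge0// !addr_ge0 ?sqr_ge0.
Qed.

Lemma l2_Re_integrable f g :
  mu.-integrable setT (EFin \o (fun n => complex.Re (f n * (g n)^*))).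
Proof.
apply: (@l2_dom_integrable f g) => n; rewrite !sqmodE conjCE.
case: (f n) (g n) => [a b] [c d] /=; rewrite mulrN opprK.
exact: normM_dom.
Qed.

Lemma l2_Im_integrable f g :
  mu.-integrable setT (EFin \o (fun n => complex.Im (f n * (g n)^*))).
Proof.
apply: (@l2_dom_integrable f g) => n; rewrite !sqmodE conjCE.
case: (f n) (g n) => [a b] [c d] /=; rewrite mulrN addrC -mulrN.
rewrite [c ^+ 2 + _]addrC -[c ^+ 2]sqrrN [a ^+ 2 + _]addrC.
rewrite (_ : b * c + a * - d = - ((- b) * c + a * d)); last by ring.
rewrite normrN; apply: le_trans (normM_dom _ _ _ _) _.
by rewrite !sqrrN; lra.
Qed.

Lemma complex_ext (x y : R[i]) : complex.Re x = complex.Re y ->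
  complex.Im x = complex.Im y -> x = y.
Proof. by case: x y => [? ?] [? ?] /= -> ->. Qed.

Lemma cnt_integrableZ (r : R) (x : nat -> R) : mu.-integrable setT (EFin \o x) ->
  mu.-integrable setT (EFin \o (fun n => r * x n)).
Proof. by move=> ix; have := @integrableZl _ _ _ mu setT measurableT r _ ix. Qed.

Lemma cnt_integrableD (x y : nat -> R) : mu.-integrable setT (EFin \o x) ->
  mu.-integrable setT (EFin \o y) ->
  mu.-integrable setT (EFin \o (fun n => x n + y n)).
Proof. by move=> ix iy; have := @integrableD _ _ _ mu setT measurableT _ _ ix iy. Qed.

Lemma l2dot_linear_l h : GRing.linear_for *%R (fun f => l2dot f h).
Proof.
move=> a f g; apply: complex_ext.
- transitivity (\int[mu]_n (complex.Re a * complex.Re (f n * (h n)^*)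
     + ((- complex.Im a) * complex.Im (f n * (h n)^*)
     + complex.Re (g n * (h n)^*)))).
    congr (fine _); apply: eq_integral => n _; congr EFin.
    rewrite l2D l2Z mulrDl -mulrA; case: a (f n * _) (g n * _) => [? ?] [? ?] [? ?] /=.
    by ring.
  have ? := l2_Re_integrable f h. have ? := l2_Im_integrable f h.
  have ? := l2_Re_integrable g h.
  rewrite RintegralD//; last 2 first.
  + exact: cnt_integrableZ.
  + by apply: cnt_integrableD => //; exact: cnt_integrableZ.
  rewrite RintegralD//; last exact: cnt_integrableZ.
  rewrite !RintegralZl//.
  by case: a => x y /=; ring.
- transitivity (\int[mu]_n (complex.Re a * complex.Im (f n * (h n)^*)
     + (complex.Im a * complex.Re (f n * (h n)^*)
     + complex.Im (g n * (h n)^*)))).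
    congr (fine _); apply: eq_integral => n _; congr EFin.
    rewrite l2D l2Z mulrDl -mulrA; case: a (f n * _) (g n * _) => [? ?] [? ?] [? ?] /=.
    by ring.
  have ? := l2_Re_integrable f h. have ? := l2_Im_integrable f h.
  have ? := l2_Im_integrable g h.
  rewrite RintegralD//; last 2 first.
  + exact: cnt_integrableZ.
  + by apply: cnt_integrableD => //; exact: cnt_integrableZ.
  rewrite RintegralD//; last exact: cnt_integrableZ.
  rewrite !RintegralZl//.
  by case: a => x y /=; ring.
Qed.

Lemma l2dot_herm f g : l2dot f g = (l2dot g f)^*.
Proof.
rewrite conjCE; apply: complex_ext; rewrite /l2dot /cintegral /=.
- congr (fine _); apply: eq_integral => n _; congr EFin.
  by rewrite !conjCE; case: (f n) (g n) => [? ?] [? ?] /=; ring.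
- rewrite -[RHS]mulN1r -RintegralZl//; last exact: l2_Im_integrable.
  congr (fine _); apply: eq_integral => n _; congr EFin.
  by rewrite !conjCE; case: (f n) (g n) => [? ?] [? ?] /=; ring.
Qed.

Lemma l2dot_bilinear : bilinear_for *%R (@Num.conj R[i] \; *%R) l2dot.
Proof.
split; first exact: l2dot_linear_l.
move=> f a g h; rewrite l2dot_herm l2dot_linear_l rmorphD rmorphM /=.
by rewrite -!l2dot_herm.
Qed.

Definition l2sqnorm f : R := fine (\int[mu]_n (sqmod (f n))%:E)%E.

Lemma l2sqnormE f : ((l2sqnorm f)%:E = \int[mu]_n (sqmod (f n))%:E)%E.
Proof.
rewrite /l2sqnorm fineK// ge0_fin_numE; first exact: l2P.
by apply: integral_ge0 => n _; rewrite lee_fin sqmod_ge0.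
Qed.

Lemma l2dotE f : l2dot f f = (l2sqnorm f)%:C%C.
Proof.
apply: complex_ext; rewrite /l2dot /cintegral /=.
- congr (fine _); apply: eq_integral => n _; congr EFin.
  by rewrite conjCE sqmodE; case: (f n) => ? ? /=; ring.
- rewrite -[RHS](fine0 : fine 0%E = (0:R)); congr (fine _).
  rewrite -[RHS](integral0 mu setT); apply: eq_integral => n _; congr EFin.
  by rewrite conjCE; case: (f n) => ? ? /=; ring.
Qed.

Lemma sqmod_le_l2sqnorm f n : sqmod (f n) <= l2sqnorm f.
Proof.
rewrite -lee_fin l2sqnormE intmuE; last by move=> k; exact: sqmod_ge0.
have h0 k : (0 <= (sqmod (f k))%:E)%E by rewrite lee_fin sqmod_ge0.
apply: (@le_trans _ _ (\sum_(0 <= k < n.+1) (sqmod (f k))%:E)%E).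
  by rewrite big_nat_recr//= leeDr// sume_ge0.
exact: nneseries_lim_ge.
Qed.

Lemma l2dot_gt0 f : f != 0 -> 0 < l2dot f f.
Proof.
move=> f0; rewrite l2dotE ltcR lt_neqAle; apply/andP; split; last first.
  exact: le_trans (sqmod_ge0 _) (sqmod_le_l2sqnorm f 0).
apply: contra f0 => /eqP s0; apply/eqP/l2_eq => n.
apply: Normc.eq0_normc; apply/eqP; rewrite -sqrf_eq0 eq_le sqr_ge0 andbT.
by rewrite s0; exact: sqmod_le_l2sqnorm.
Qed.

HB.instance Definition _ :=
  bilinear_isBilinear.Build _ _ _ _ _ _ l2dot l2dot_bilinear.
HB.instance Definition _ := isHermitianSesquilinear.Build _ _ false (@Num.conj R[i])
  l2dot (fun f g => etrans (l2dot_herm f g) (esym (mul1r _))).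
HB.instance Definition _ := isDotProduct.Build _ _ l2dot l2dot_gt0.

Definition l2norm f : R[i] := sqrtC (l2dot f f).

Lemma l2normD f g : l2norm (f + g) <= l2norm f + l2norm g.
Proof. exact: dot_triangle. Qed.

Lemma l2normZ a f : l2norm (a *: f) = `|a| * l2norm f.
Proof.
rewrite /l2norm dnormZ sqrtCM ?nnegrE ?exprn_ge0 ?dnorm_ge0//.
by rewrite sqrCK.
Qed.

Lemma l2norm0_eq0 f : l2norm f = 0 -> f = 0.
Proof. by move=> /eqP; rewrite sqrt_dnorm_eq0 => /eqP. Qed.

HB.instance Definition _ := Lmodule_isNormed.Build R[i] l2 l2normD l2normZ l2norm0_eq0.

Lemma l2_normE f : `|f| ^+ 2 = l2dot f f.
Proof. exact: sqrtCK. Qed.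
End L2dot.

Section L2complete.
Variable R : realType.
Local Notation mu := (@counting nat R).
Local Notation l2 := (l2 R).

Lemma posC (e : R[i]) : 0 < e -> exists2 r : R, 0 < r & e = r%:C%C.
Proof.
case: e => x y; rewrite ltcE /= => /andP[/eqP -> x0].
by exists x.
Qed.

Lemma l2_norm_ltP (f : l2) (r : R) : 0 < r ->
  (`|f| < r%:C%C) = (l2sqnorm f < r ^+ 2).
Proof.
move=> r0; rewrite -(@ltr_pXn2r _ 2)// ?nnegrE ?normr_ge0 ?ler0c ?(ltW r0)//.
by rewrite l2_normE l2dotE -rmorphXn ltcR.
Qed.

Lemma l2_norm_leP (f : l2) (r : R) : 0 <= r ->
  (`|f| <= r%:C%C) = (l2sqnorm f <= r ^+ 2).
Proof.
move=> r0; rewrite -(@ler_pXn2r _ 2)// ?nnegrE ?normr_ge0 ?ler0c//.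
by rewrite l2_normE l2dotE -rmorphXn lecR.
Qed.

Lemma l2_norm_coord (f : l2) (r : R) n : 0 < r -> `|f| < r%:C%C ->
  `|complex.Re (f n)| < r /\ `|complex.Im (f n)| < r.
Proof.
move=> r0; rewrite l2_norm_ltP// => h.
have := le_lt_trans (sqmod_le_l2sqnorm f n) h; rewrite sqmodE => {}h.
have sq (x : R) : x ^+ 2 < r ^+ 2 -> `|x| < r.
  by rewrite -real_normK ?num_real// ltr_pXn2r// nnegrE ltW.
split; apply: sq; apply: le_lt_trans h; first by rewrite lerDl sqr_ge0.
by rewrite lerDr sqr_ge0.
Qed.

Lemma l2_complete (F : set_system l2) : ProperFilter F -> cauchy F -> cvg F.
Proof.
move=> FF /cauchyP Fc.
have Fball (e : R) : 0 < e -> exists2 y : l2, F (fun x => `|y - x| < e%:C%C) & True.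
  move=> e0; have [|y Fy] := Fc e%:C%C; first by rewrite ltcR.
  by exists y.
have cRe n : cvg ((fun x : l2 => complex.Re (x n)) @ F).
  apply: cauchy_cvg; apply: cauchy_exP => e /= e0.
  have [y Fy _] := Fball e e0; exists (complex.Re (y n)).
  rewrite /nbhs /=; apply: filterS Fy => x /l2_norm_coord -/(_ n e0)[+ _].
  by rewrite l2B raddfB.
have cIm n : cvg ((fun x : l2 => complex.Im (x n)) @ F).
  apply: cauchy_cvg; apply: cauchy_exP => e /= e0.
  have [y Fy _] := Fball e e0; exists (complex.Im (y n)).
  rewrite /nbhs /=; apply: filterS Fy => x /l2_norm_coord -/(_ n e0)[_ +].
  by rewrite l2B raddfB.
pose f n : R[i] := Complex (lim ((fun x : l2 => complex.Re (x n)) @ F))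
                    (lim ((fun x : l2 => complex.Im (x n)) @ F)).
have sumle (e : R) (y : l2) N : 0 < e -> F (fun x => `|y - x| < e%:C%C) ->
    \sum_(0 <= k < N) sqmod (y k - f k) <= e ^+ 2.
  move=> e0 Fy.
  have cv : (fun x : l2 => \sum_(0 <= k < N) sqmod (y k - x k)) @ F -->
      \sum_(0 <= k < N) sqmod (y k - f k).
    apply: cvg_big => [|k _]; first exact: add_continuous.
    rewrite (_ : sqmod _ = (complex.Re (y k) - complex.Re (f k)) *
        (complex.Re (y k) - complex.Re (f k)) +
        (complex.Im (y k) - complex.Im (f k)) *
        (complex.Im (y k) - complex.Im (f k))); last first.
      by rewrite sqmodE !raddfB /= !expr2.
    rewrite (_ : (fun x : l2 => _) = (fun x : l2 =>
        (complex.Re (y k) - complex.Re (x k)) *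
        (complex.Re (y k) - complex.Re (x k)) +
        (complex.Im (y k) - complex.Im (x k)) *
        (complex.Im (y k) - complex.Im (x k)))); last first.
      by apply/funext => x; rewrite sqmodE !raddfB /= !expr2.
    have yRe : (fun x : l2 => complex.Re (y k) - complex.Re (x k)) @ F -->
        complex.Re (y k) - complex.Re (f k).
      by apply: cvgB; [exact: cvg_cst|exact: cRe].
    have yIm : (fun x : l2 => complex.Im (y k) - complex.Im (x k)) @ F -->
        complex.Im (y k) - complex.Im (f k).
      by apply: cvgB; [exact: cvg_cst|exact: cIm].
    exact: (cvgD (cvgM yRe yRe) (cvgM yIm yIm)).
  rewrite -(cvg_lim _ cv)//; apply: limr_le; first exact: cvgP cv.
  apply: filterS Fy => x; rewrite l2_norm_ltP// => /ltW; apply: le_trans.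
  rewrite -lee_fin l2sqnormE intmuE; last by move=> k; exact: sqmod_ge0.
  rewrite -sumEFin; apply: nneseries_lim_ge => k _ _.
  by rewrite lee_fin sqmod_ge0.
have intle (e : R) (y : l2) : 0 < e -> F (fun x => `|y - x| < e%:C%C) ->
    (\int[mu]_n (sqmod (y n - f n))%:E <= (e ^+ 2)%:E)%E.
  move=> e0 Fy; rewrite intmuE; last by move=> k; exact: sqmod_ge0.
  apply: lime_le; first by apply: is_cvg_nneseries => k _ _; rewrite lee_fin sqmod_ge0.
  by apply: nearW => N; rewrite sumEFin lee_fin; exact: sumle.
have f2 : f \in @l2_pred R.
  have [y Fy _] := Fball 1 ltr01.
  have -> : f = (y : nat -> R[i]) - ((y : nat -> R[i]) - f).
    by apply/funext => n; rewrite opprB addrC subrK.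
  apply: rpredB; first by case: (y).
  apply/l2_predE; apply: le_lt_trans (ltry (1 ^+ 2)).
  exact: (intle 1 y).
pose g : l2 := L2 f2.
apply/cvg_ex; exists g; apply/cvgrPdist_lt => eps /posC[e e0 ->].
have e20 : 0 < e / 2 by rewrite divr_gt0.
have [y Fy _] := Fball (e / 2) e20.
have yg : `|y - g| <= (e / 2)%:C%C.
  rewrite l2_norm_leP ?(ltW e20)// -lee_fin l2sqnormE.
  exact: intle.
near=> x.
rewrite (_ : g - x = (y - x) - (y - g)); last by rewrite opprB [RHS]addrC subrKA.
apply: le_lt_trans (ler_normB _ _) _.
rewrite (splitr e) rmorphD; apply: ltr_leD => //.
by near: x.
Unshelve. all: by end_near. Qed.

HB.instance Definition _ := Uniform_isComplete.Build l2 l2_complete.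
End L2complete.

Record hilbert (R : realType) := Hilbert {
  hspace :> completeNormedModType R[i];
  hdot : {dot hspace for @Num.conj R[i]};
  hnormE : forall x : hspace, `|x| ^+ 2 = hdot x x }.

Canonical l2_hilbert (R : realType) : hilbert R :=
  @Hilbert R (l2 R) (@l2dot R) (@l2_normE R).

Section Operators.
Variables (R : realType) (H : hilbert R).
Implicit Types T : H -> H.

Definition bounded_operator T : Prop :=
  linear T /\ exists M : R, forall f, `|T f| <= M%:C%C * `|f|.

(* The choice below is unique ([adjointE]); it exists for bounded T by the
   Riesz representation theorem. *)
Definition adjoint T (g : H) : H :=
  xget 0 [set g' : H | forall f, hdot H (T f) g = hdot H f g'].

Lemma adjointE T g g' :
  (forall f, hdot H (T f) g = hdot H f g') -> adjoint T g = g'.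
Proof.
move=> Tg; rewrite /adjoint; case: xgetP => [h _ hT|/(_ g')]; last by [].
apply/eqP; rewrite -subr_eq0 -(dnorm_eq0 (hdot H)) linearBr/=.
by rewrite -hT -Tg subrr.
Qed.

Definition normal_operator T : Prop :=
  bounded_operator T /\ forall f, adjoint T (T f) = T (adjoint T f).

Definition two_isometry T : Prop :=
  bounded_operator T /\ forall f : H,
    f - 2 *: adjoint T (T f) + adjoint T (adjoint T (T (T f))) = 0.

(* T (T^* T)^-1; meaningful for T bounded below, when T^* T is a bijection. *)
Definition cauchy_dual T (g : H) : H :=
  T (xget 0 [set f : H | adjoint T (T f) = g]).

End Operators.

(* V embeds H isometrically in K, and T is the restriction to H of N. *)
Definition subnormal (R : realType) (H : hilbert R) (T : H -> H) : Prop :=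
  exists (K : hilbert R) (V : H -> K) (N : K -> K),
    [/\ linear V, (forall f, `|V f| = `|f|), normal_operator N &
        forall f, N (V f) = V (T f)].

Section CompositionOperators.
Variable R : realType.
Implicit Types (phi psi : nat -> nat) (w u : nat -> R[i]).
Local Notation mu := (@counting nat R).

Definition wco_domain phi w : set (l2_hilbert R) :=
  [set f : l2 R | square_integrable (fun n => w n * f (phi n))].

(* Outside of [wco_domain phi w] this has the irrelevant value 0. *)
Definition wco phi w (f : l2_hilbert R) : l2_hilbert R :=
  insubd (0 : l2 R) (fun n => w n * (f : l2 R) (phi n)).

Lemma wcoE phi w (f : l2 R) n : wco_domain phi w f ->
  (wco phi w f : l2 R) n = w n * f (phi n).
Proof.
by move=> h; rewrite /wco /insubd insubT//; apply/l2_predE.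
Qed.

Definition wmeasure psi u (A : set nat) : \bar R :=
  (\int[mu]_(j in psi @^-1` A) (sqmod (u j))%:E)%E.

Definition is_RN_derivative psi u (h : nat -> \bar R) : Prop :=
  (forall k, 0 <= h k)%E /\
  forall A : set nat, wmeasure psi u A = (\int[mu]_(k in A) h k)%E.

(* Exists and is unique: see [RN_derivativeP] and [RN_derivativeE]. *)
Definition RN_derivative psi u : nat -> \bar R :=
  xget (cst 0%E) [set h | is_RN_derivative psi u h].

Lemma counting_int_esum (A : set nat) (F : nat -> \bar R) :
  (forall k, 0 <= F k)%E -> (\int[mu]_(k in A) F k = \esum_(k in A) F k)%E.
Proof.
move=> F0; rewrite integral_mkcond ge0_integral_count; last first.
  by move=> k; rewrite patchE; case: ifP.
rewrite nneseries_esumT; last by move=> k; rewrite patchE; case: ifP.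
by rewrite [RHS]esum_mkcond.
Qed.

Lemma RN_derivative_exists psi u :
  is_RN_derivative psi u
    (fun k => \esum_(j in psi @^-1` [set k]) (sqmod (u j))%:E)%E.
Proof.
have h0 k : (0 <= \esum_(j in psi @^-1` [set k]) (sqmod (u j))%:E)%E.
  by apply: esum_ge0 => j _; rewrite lee_fin sqmod_ge0.
split=> // A; rewrite /wmeasure !counting_int_esum//; last first.
  by move=> k; rewrite lee_fin sqmod_ge0.
rewrite esum_esum; last by move=> *; rewrite lee_fin sqmod_ge0.
rewrite (reindex_esum (psi @^-1` A) (A `*`` (fun k => psi @^-1` [set k])) (fun j => (psi j, j)))//.
split.
- by move=> j /= Aj; split.
- by move=> i j _ _ [_ ->].
- by move=> [k j] /= [Ak pk]; exists j; rewrite /= pk.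
Qed.

Lemma RN_derivativeP psi u : is_RN_derivative psi u (RN_derivative psi u).
Proof.
rewrite /RN_derivative; case: xgetP => [//|/(_ _ (RN_derivative_exists psi u))].
by [].
Qed.

Lemma RN_derivativeE psi u k :
  (RN_derivative psi u k = \esum_(j in psi @^-1` [set k]) (sqmod (u j))%:E)%E.
Proof.
have [h0 /(_ [set k])] := RN_derivativeP psi u.
have [g0 /(_ [set k]) ->] := RN_derivative_exists psi u.
by rewrite !counting_int_esum// !esum_set1.
Qed.

Definition dual_weight phi w (n : nat) : R[i] :=
  if w n == 0 then 0 else w n / (fine (RN_derivative phi w (phi n)))%:C%C.

(* [weight_prod phi u n] is the product of the u \o phi^j for j < n. *)
Definition weight_prod phi u (n k : nat) : R[i] :=
  \prod_(j < n) u (iter j phi k).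

(* A measure on [0, 1] is given as a Borel measure on the line of which only
   the trace on [0, 1] is used. *)
Definition hausdorff_moment (gamma : nat -> R) : Prop :=
  exists nu : {measure set (measurableTypeR R) -> \bar R},
    forall n, ((gamma n)%:E = \int[nu]_(t in `[0%R, 1%R]) (t ^+ n)%:E)%E.
Definition alpha w : R := sqmod (w 0%N) + sqmod (w 1%N).
End CompositionOperators.

(* Main.v *)
Require Import Defs.
From HB Require Import structures.
From mathcomp Require Import all_boot all_order all_algebra.
From mathcomp Require Import complex.
From mathcomp Require Import all_classical all_reals all_analysis.
From mathcomp Require Import measurable_realfun ring lra zify.

Set Implicit Arguments.
Unset Strict Implicit.
Unset Printing Implicit Defensive.

Import Order.TTheory GRing.Theory Num.Theory.
Import numFieldNormedType.Exports.

Local Open Scope classical_set_scope.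
Local Open Scope ring_scope.

(** The Cauchy dual S acts on the standard basis by S e_0 = p e_0 + q e_1, with
p = w 0 / alpha and q = w 1 / alpha, and as a weighted shift beyond e_0.  For a
2-isometry the squared norms of the iterates of a vector form an arithmetic
progression, which determines the moduli of the weights: the squared norm of
S^n e_1 is 1 / (1 + n c) with c = |w 2|^2 - 1 >= 0.  The squared norm of S^n e_0
is the derivative h n at 0, and summing squared moduli of products of weights
over the fibre of 0 gives its closed form.  With s = |p|^2 and Q = |q|^2 it
satisfies h 0 = 1 and h (n+1) = s h n + Q / (1 + n c).

The relation |w 1|^2 c = (1 - |w 0|^2) (alpha - 1) (weight_relation) forces
alpha >= 1 and supplies the values of the parameters in the degenerate cases.
Subnormality and the moment property are then both decided case by case.

If w 0, w 1 and c are all nonzero, both fail.  A measure with moments h n would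
satisfy (t - s) dm = Q dt^(1/c) on the unit interval, and hence be negative
between 0 and s; concretely, the functional sending t^n to h n is negative at
(t - s)^2 (1 - t)^(2k) for large k (defect_moment_not_positive).  This
contradicts the moment property directly.  It contradicts subnormality because
for a normal extension N and A = N^* N the functional is
f |-> < f(A) e_0, e_0 >, which is nonnegative at squares
(perturbed_shift_not_subnormal).

In the other cases both hold.  If w 1 = 0, then e_0 is an eigenvector and h is
constant; if w 0 = 0, then S is a weighted shift and h n = 1 / (1 + n e) with
e = alpha - 1; if c = 0, then S beyond e_0 is isometric and h is a mixture of
the powers of 1 and of s.  The measures are explicit.  The normal extensions are
compressed into one model on square-summable sequences: the tensor product of a
bilateral shift with a self-adjoint Jacobi matrix J, plus a scalar.  The matrix
J represents multiplication by t on the L^2 space of a measure with moments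
1 / (1 + n kappa), in a basis of Jacobi polynomials, so that the vectors J^m e_0
have explicit coordinates and inner products (jacobi_recurrence,
hdot_moment_vector).  These vectors realize the weighted shifts inside the model,
and for c = 0 the image of e_0 is found by solving a linear equation with a
geometric series.

Adjoints come from the Riesz representation theorem (riesz_functional), and
identities between bounded operators are checked on basis vectors. *)

(** * Squared moduli and inner products *)

Section SquaredModulus.
Variable R : realType.
Implicit Types (z : R[i]) (r : R).

Lemma sqmod_real r : sqmod (r%:C%C : R[i]) = r ^+ 2.
Proof. by rewrite sqmodE /= expr0n addr0. Qed.

Lemma sqmod1 : sqmod (1 : R[i]) = 1.
Proof. by rewrite sqmodE /= expr1n expr0n addr0. Qed.

Lemma sqmodX z n : sqmod (z ^+ n) = sqmod z ^+ n.
Proof.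
by elim: n => [|n IH]; [rewrite !expr0 sqmod1|rewrite !exprS sqmodM IH].
Qed.

Lemma sqmodV z : sqmod z^-1 = (sqmod z)^-1.
Proof. by rewrite /sqmod Normc.normcV exprVn. Qed.

Lemma sqmod_divr z r : sqmod (z / r%:C%C) = sqmod z / r ^+ 2.
Proof. by rewrite sqmodM sqmodV sqmod_real. Qed.

Lemma sqmod_prod (I : Type) (r : seq I) (F : I -> R[i]) :
  sqmod (\prod_(i <- r) F i) = \prod_(i <- r) sqmod (F i).
Proof. exact: (big_morph (@sqmod R) (@sqmodM R) sqmod1). Qed.

Lemma sqmod_eq0 z : (sqmod z == 0) = (z == 0).
Proof.
apply/eqP/eqP => [/eqP|->]; last exact: sqmod0.
by rewrite /sqmod expf_eq0 => /eqP/Normc.eq0_normc.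
Qed.

Lemma conj_real r : (r%:C%C)^* = r%:C%C :> R[i].
Proof. by rewrite conjCE conjc_real. Qed.

End SquaredModulus.

Section InnerProduct.
Variables (R : realType) (H : hilbert R).
Implicit Types (x y z : H) (a b : R[i]).

Local Notation dot := (hdot H).

Lemma hdotC x y : dot x y = (dot y x)^*.
Proof. by rewrite hermC/= expr0 mul1r. Qed.

Lemma hdotDl x y z : dot (x + y) z = dot x z + dot y z.
Proof. exact: linearDl. Qed.

Lemma hdotDr x y z : dot x (y + z) = dot x y + dot x z.
Proof. exact: linearDr. Qed.

Lemma hdotBl x y z : dot (x - y) z = dot x z - dot y z.
Proof. exact: linearBl. Qed.

Lemma hdotBr x y z : dot x (y - z) = dot x y - dot x z.
Proof. exact: linearBr. Qed.

Lemma hdotZl a x y : dot (a *: x) y = a * dot x y.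
Proof. exact: linearZl_LR. Qed.

Lemma hdotZr a x y : dot x (a *: y) = a^* * dot x y.
Proof. exact: linearZr_LR. Qed.

Lemma hdot_suml (I : Type) (r : seq I) (P : pred I) (F : I -> H) y :
  dot (\sum_(i <- r | P i) F i) y = \sum_(i <- r | P i) dot (F i) y.
Proof. exact: linear_sumlz. Qed.

Lemma hdot_inj x y : (forall z, dot z x = dot z y) -> x = y.
Proof.
move=> xy; apply/eqP; rewrite -subr_eq0 -(dnorm_eq0 dot).
by rewrite hdotBr xy subrr.
Qed.

Definition hsqnorm x : R := complex.Re (dot x x).

Lemma hsqnormE x : dot x x = (hsqnorm x)%:C%C.
Proof. by rewrite /hsqnorm RRe_real// ger0_real// dnorm_ge0. Qed.

Lemma hsqnorm_ge0 x : 0 <= hsqnorm x.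
Proof. by have := dnorm_ge0 dot x; rewrite hsqnormE ler0c. Qed.

Lemma hnorm_sqr x : `|x| ^+ 2 = (hsqnorm x)%:C%C.
Proof. by rewrite hnormE hsqnormE. Qed.

Lemma hsqnormD x y :
  hsqnorm (x + y) = hsqnorm x + hsqnorm y + 2 * complex.Re (dot x y).
Proof.
rewrite /hsqnorm hdotDl !hdotDr (hdotC y x) conjCE.
by case: (dot x x) (dot x y) (dot y y) => [? ?] [? ?] [? ?] /=; ring.
Qed.

Lemma hsqnormZ a x : hsqnorm (a *: x) = sqmod a * hsqnorm x.
Proof.
rewrite {1}/hsqnorm hdotZl hdotZr hsqnormE conjCE sqmodE.
by case: a => ? ? /=; ring.
Qed.

End InnerProduct.
(** * Bounded functionals are represented by vectors *)

Section Riesz.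
Variables (R : realType) (H : hilbert R).
Implicit Types (x y z : H) (a b : R[i]).

Local Notation dot := (hdot H).
Local Notation Re := complex.Re.

Lemma Re_hdot_le x y : Re (dot x y) ^+ 2 <= hsqnorm x * hsqnorm y.
Proof.
have := dot_CauchySchwarz dot x y.
rewrite !hsqnormE -sqmodC -rmorphM lecR sqmodE; apply: le_trans.
by rewrite lerDl sqr_ge0.
Qed.

(** The sign of the discriminant, including the case of a vanishing leading
coefficient. *)
Lemma sqr_le_of_quadratic_ge0 (e b h : R) : 0 <= h ->
  (forall t, 0 <= e + 2 * t * b + t ^+ 2 * h) -> b ^+ 2 <= e * h.
Proof.
move=> h0 q; have [hz|hz] := eqVneq h 0.
  rewrite hz mulr0; have [->|b0] := eqVneq b 0; first by rewrite expr0n.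
  have := q (- (e + 1) / (2 * b)); rewrite hz mulr0 addr0.
  rewrite (_ : _ + _ = -1); first by rewrite ler0N1.
  by field.
have hp : 0 < h by rewrite lt_neqAle eq_sym hz.
have := q (- b / h).
rewrite (_ : _ + _ = (e * h - b ^+ 2) / h); last by field.
by rewrite pmulr_lge0 ?invr_gt0// subr_ge0.
Qed.

Section Functional.
Variable F : H -> R[i].
Hypothesis F_linear : forall a x y, F (a *: x + y) = a * F x + F y.
Variable M : R.
Hypothesis F_bounded : forall x, sqmod (F x) <= M * hsqnorm x.

Let FD x y : F (x + y) = F x + F y.
Proof. by rewrite -[x]scale1r F_linear mul1r scale1r. Qed.

Let F0 : F 0 = 0.
Proof. by apply: (addrI (F 0)); rewrite -FD !addr0. Qed.

Let FZ a x : F (a *: x) = a * F x.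
Proof. by rewrite -[a *: x]addr0 F_linear F0 addr0. Qed.

(* The representing vector is the minimizer of this functional, which equals
   the squared distance to it up to a constant. *)
Let energy x : R := hsqnorm x - 2 * Re (F x).

Let energy_bounded : has_inf (range energy).
Proof.
split; first by exists (energy 0), 0.
exists (- `|M|) => _ [x _ <-]; rewrite /energy -subr_ge0 opprK.
have := F_bounded x; have h0 := hsqnorm_ge0 x; rewrite sqmodE => b.
have {b} : Re (F x) ^+ 2 <= M * hsqnorm x.
  by apply: le_trans b; rewrite lerDl sqr_ge0.
move: (Re (F x)) (hsqnorm x) h0 => t h h0 tM.
have {}tM : t ^+ 2 <= `|M| * h.
  by apply: le_trans tM _; rewrite ler_wpM2r// ler_norm.
move: (`|M|) (normr_ge0 M) tM => K K0 tM.
rewrite leNgt; apply/negP => lt; have := sqr_ge0 (h - K); nra.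
Qed.

Let minimum := inf (range energy).

Let minimum_le x : minimum <= energy x.
Proof. by apply: ge_inf; [case: energy_bounded|exists x]. Qed.

Let energyD x f (t : R) : energy (x + t%:C%C *: f) =
  energy x + 2 * t * Re (dot f x - F f) + t ^+ 2 * hsqnorm f.
Proof.
rewrite /energy hsqnormD hsqnormZ FD FZ hdotC hdotZl sqmodE /=.
rewrite conjCE; case: (dot f x) (F x) (F f) => [? ?] [? ?] [? ?] /=; ring.
Qed.

(* Strict convexity in quantitative form: near-minimizers are close to each
   other, so minimizing sequences are Cauchy. *)
Let parallelogram x y : hsqnorm (x - y) =
  2 * energy x + 2 * energy y - 4 * energy ((2^-1)%:C%C *: (x + y)).
Proof.
have half2 : ((2^-1 : R)%:C%C) = 2^-1 :> R[i] by rewrite fmorphV rmorph_nat.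
rewrite -scaleN1r hsqnormD hsqnormZ /energy hsqnormZ hsqnormD FZ FD.
rewrite hdotZr !sqmodE rmorphN rmorph1.
by case: (F x) (F y) (dot x y) => [? ?] [? ?] [? ?] /=; field.
Qed.

(** Riesz representation.  At an n-th near-minimizer u n the quadratic in t
given by the energy along a line is bounded below by the minimum, which bounds
the first-order term by a multiple of 1 / n; so the first-order term vanishes
at the limit.  This gives the real parts, and multiplication of the test vector
by the imaginary unit gives the imaginary parts. *)
Lemma riesz_functional : exists r, forall f, F f = dot f r.
Proof.
have seq_ex n : exists x, energy x < minimum + n.+1%:R^-1.
  have [||_ [x _ <-] lt] := @inf_adherent _ (range energy) (n.+1%:R^-1) => //.
  by exists x.
have [u uP] := choice seq_ex.
have u_dist n m : hsqnorm (u n - u m) <= 2 * n.+1%:R^-1 + 2 * m.+1%:R^-1.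
  rewrite parallelogram.
  have := uP n; have := uP m; have := minimum_le ((2^-1)%:C%C *: (u n + u m)).
  move: (energy _) (energy _) (energy _) (n.+1%:R^-1) (m.+1%:R^-1) => a b c d e.
  lra.
have ucvg : cvgn u.
  apply: cauchy_cvg; apply: cauchy_exP => e /posC[r r0 ->].
  have [N _ NP] : \forall n \near \oo, (n.+1%:R^-1 : R) < r ^+ 2 / 4.
    by apply: near_infty_natSinv_lt (PosNum (_ : 0 < r ^+ 2 / 4)); rewrite divr_gt0// exprn_gt0.
  exists (u N), N => // n /= Nn; rewrite -ball_normE/=.
  rewrite -(@ltr_pXn2r _ 2)// ?nnegrE ?normr_ge0 ?ler0c ?(ltW r0)//.
  rewrite hnorm_sqr -rmorphXn ltcR; apply: le_lt_trans (u_dist _ _) _.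
  have := NP n Nn; have := NP N (leqnn _) => /=.
  move: (r ^+ 2) (n.+1%:R^-1) (N.+1%:R^-1) => a b c; lra.
exists (lim (u @ \oo)) => f.
have re_eq g : Re (dot g (lim (u @ \oo)) - F g) = 0.
  set b := Re _; apply/eqP; rewrite -sqrf_eq0 eq_le sqr_ge0 andbT.
  apply/ler_addgt0Pl => e e0; rewrite addr0.
  have hg := hsqnorm_ge0 g.
  pose d := e / (4 * (hsqnorm g + 1)).
  have d0 : 0 < d by rewrite divr_gt0// mulr_gt0// ltr_wpDl.
  have /cvgrPdist_lt/(_ (Num.sqrt d)%:C%C) := ucvg.
  rewrite ltcR sqrtr_gt0 => /(_ d0) near1.
  have near2 : \forall n \near \oo, (n.+1%:R^-1 : R) < d.
    by exact: near_infty_natSinv_lt (PosNum d0).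
  have [n []] := filter_ex (filterI near1 near2).
  rewrite -(@ltr_pXn2r _ 2)// ?nnegrE ?normr_ge0 ?ler0c ?sqrtr_ge0//.
  rewrite hnorm_sqr -rmorphXn ltcR sqr_sqrtr ?(ltW d0)// => lim_d n_d.
  set c := Re (dot g (u n) - F g).
  have c2 : c ^+ 2 <= n.+1%:R^-1 * hsqnorm g.
    apply: sqr_le_of_quadratic_ge0 => // t.
    have := minimum_le (u n + t%:C%C *: g); rewrite energyD -/c.
    have := uP n; move: (energy _) (t ^+ 2 * _) (2 * t * c) (n.+1%:R^-1).
    by move=> *; lra.
  have bc2 : (b - c) ^+ 2 <= hsqnorm g * hsqnorm (lim (u @ \oo) - u n).
    rewrite /b /c -raddfB /= opprB addrA subrK -hdotBr.
    exact: Re_hdot_le.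
  have dE : d * (4 * (hsqnorm g + 1)) = e.
    by rewrite divfK// mulf_neq0// gt_eqF// ltr_wpDl.
  rewrite -dE.
  have c3 : c ^+ 2 <= d * hsqnorm g.
    by apply: le_trans c2 _; rewrite ler_wpM2r// ltW.
  have bc3 : (b - c) ^+ 2 <= hsqnorm g * d.
    by apply: le_trans bc2 _; rewrite ler_wpM2l// ltW.
  move: c3 bc3 d0 hg; clearbody b c d; move: (hsqnorm g) => h *.
  have : b ^+ 2 <= 2 * c ^+ 2 + 2 * (b - c) ^+ 2.
    by rewrite -subr_ge0 (_ : _ - _ = (b - 2 * c) ^+ 2) ?sqr_ge0//; ring.
  nra.
apply/esym/eqP; rewrite -subr_eq0; apply/eqP/complex_ext; first exact: re_eq.
have := re_eq ('i%C *: f); rewrite FZ hdotZl -mulrBr.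
by case: (_ - _) => ? ?; rewrite /= mul0r mul1r add0r => /eqP; rewrite oppr_eq0 => /eqP.
Qed.

End Functional.
End Riesz.
(** * Bounded linear maps and their adjoints *)

Section BoundedLinear.
Variable R : realType.
Implicit Types H K L : hilbert R.

(** Boundedness in terms of squared norms, which are real numbers, and between
possibly different spaces. *)
Definition bounded_linear H K (T : H -> K) : Prop :=
  linear T /\ exists M : R, forall x, hsqnorm (T x) <= M * hsqnorm x.

Lemma bounded_operatorP H (T : H -> H) :
  bounded_operator T <-> bounded_linear T.
Proof.
split=> -[lT [M bM]]; split=> //.
  exists (M ^+ 2) => x; rewrite -lecR rmorphM rmorphXn /= -!hnorm_sqr -exprMn.
  by rewrite ler_pXn2r ?nnegrE ?normr_ge0// (le_trans _ (bM x)).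
exists (Num.sqrt `|M|) => x.
rewrite -(@ler_pXn2r _ 2)// ?nnegrE ?mulr_ge0 ?ler0c ?sqrtr_ge0//.
rewrite exprMn !hnorm_sqr -rmorphXn sqr_sqrtr// -rmorphM lecR.
by apply: le_trans (bM x) _; rewrite ler_wpM2r ?hsqnorm_ge0// ler_norm.
Qed.

Lemma linear_map0 H K (T : H -> K) : linear T -> T 0 = 0.
Proof.
by move=> lT; apply: (addIr (T 0)); rewrite add0r -{1}[T 0]scale1r -lT scale1r addr0.
Qed.

Lemma linear_mapZ H K (T : H -> K) a x : linear T -> T (a *: x) = a *: T x.
Proof. by move=> lT; rewrite -[a *: x]addr0 lT linear_map0 ?addr0. Qed.

Lemma linear_mapD H K (T : H -> K) x y : linear T -> T (x + y) = T x + T y.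
Proof. by move=> lT; rewrite -[x]scale1r lT !scale1r. Qed.

Lemma linear_mapB H K (T : H -> K) x y : linear T -> T (x - y) = T x - T y.
Proof.
by move=> lT; rewrite -[- y]scaleN1r (linear_mapD _ _ lT) (linear_mapZ _ _ lT) scaleN1r.
Qed.

Lemma linear_iter K (T : K -> K) j : linear T -> linear (iter j T).
Proof. by move=> lT; elim: j => // j IH a x y; rewrite !iterS IH lT. Qed.

Lemma bounded_linear_comp H K L (T : K -> L) (S : H -> K) :
  bounded_linear T -> bounded_linear S -> bounded_linear (T \o S).
Proof.
move=> [lT [M bM]] [lS [N bN]]; split; first by move=> a x y /=; rewrite lS lT.
exists (`|M| * N) => x /=; apply: le_trans (bM _) _; rewrite -mulrA.
apply: (@le_trans _ _ (`|M| * hsqnorm (S x))).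
  by rewrite ler_wpM2r ?hsqnorm_ge0// ler_norm.
by rewrite ler_wpM2l.
Qed.

Lemma bounded_linearD H K (T S : H -> K) :
  bounded_linear T -> bounded_linear S ->
  bounded_linear (fun x => T x + S x).
Proof.
move=> [lT [M bM]] [lS [N bN]]; split.
  by move=> a x y /=; rewrite lS lT scalerDr !addrA; congr (_ + _); rewrite addrAC.
exists (2 * M + 2 * N) => x; rewrite mulrDl -!mulrA.
apply: (@le_trans _ _ (2 * hsqnorm (T x) + 2 * hsqnorm (S x))); last first.
  by rewrite lerD// ler_wpM2l.
have := hsqnorm_ge0 (T x + -1 *: S x); rewrite !hsqnormD hsqnormZ hdotZr.
rewrite sqmodE rmorphN rmorph1; case: (hdot K _ _) => ? ? /=; lra.
Qed.

Lemma adjoint_exists H K (T : H -> K) : bounded_linear T ->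
  exists S : K -> H, forall x y, hdot K (T x) y = hdot H x (S y).
Proof.
move=> [lT [M bM]].
have r_ex y : exists r, forall x, hdot K (T x) y = hdot H x r.
  apply: (@riesz_functional _ _ _ _ (M * hsqnorm y)).
    by move=> a u v; rewrite lT hdotDl hdotZl.
  move=> x; rewrite mulrAC; have := dot_CauchySchwarz (hdot K) (T x) y.
  rewrite !hsqnormE -sqmodC -rmorphM lecR => /le_trans; apply.
  by rewrite ler_wpM2r ?hsqnorm_ge0.
by have [S SP] := choice r_ex; exists S.
Qed.

(** Cauchy-Schwarz applied to S y and y, then division by the squared norm of
S y. *)
Lemma bounded_linear_adjoint H K (T : H -> K) (S : K -> H) :
  bounded_linear T -> (forall x y, hdot K (T x) y = hdot H x (S y)) ->
  bounded_linear S.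
Proof.
move=> [lT [M bM]] TS; split.
  by move=> a x y; apply: hdot_inj => z; rewrite hdotDr hdotZr -!TS hdotDr hdotZr.
exists `|M| => y; have [->|y0] := eqVneq (hsqnorm (S y)) 0.
  by rewrite mulr_ge0 ?hsqnorm_ge0.
have h0 : 0 < hsqnorm (S y) by rewrite lt_neqAle eq_sym y0 hsqnorm_ge0.
rewrite -(@ler_pM2l _ (hsqnorm (S y)))//.
have := dot_CauchySchwarz (hdot K) (T (S y)) y; rewrite TS !hsqnormE.
rewrite ger0_norm ?ler0c ?hsqnorm_ge0// -!rmorphM -?rmorphXn lecR => /le_trans; apply.
rewrite mulrA ler_wpM2r ?hsqnorm_ge0// mulrC.
by apply: le_trans (bM _) _; rewrite ler_wpM2r ?hsqnorm_ge0// ler_norm.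
Qed.

Lemma hdot_adjoint H (T : H -> H) x y : bounded_linear T ->
  hdot H (T x) y = hdot H x (adjoint T y).
Proof.
move=> bT; have [S TS] := adjoint_exists bT.
by rewrite TS (@adjointE _ _ T y (S y)).
Qed.

Lemma hdot_adjoint_l H (T : H -> H) x y : bounded_linear T ->
  hdot H (adjoint T x) y = hdot H x (T y).
Proof. by move=> bT; rewrite hdotC -hdot_adjoint// -hdotC. Qed.

(** Polarization. *)
Lemma hdot_isometry H K (V : H -> K) x y : linear V ->
  (forall z, `|V z| = `|z|) -> hdot K (V x) (V y) = hdot H x y.
Proof.
move=> lV iV.
have sqV z : hsqnorm (V z) = hsqnorm z.
  by apply/complexI; rewrite -!hnorm_sqr iV.
have re u v : complex.Re (hdot K (V u) (V v)) = complex.Re (hdot H u v).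
  have := sqV (u + v); rewrite linear_mapD// !hsqnormD !sqV; lra.
apply: complex_ext; first exact: re.
have := re ('i%C *: x) y; rewrite linear_mapZ// !hdotZl.
by case: (hdot K _ _) (hdot H _ _) => [? ?] [? ?] /=; lra.
Qed.

End BoundedLinear.
(** * Coordinates in the space of square-summable sequences *)

Section SquareSummable.
Variable R : realType.
Implicit Types (K : hilbert R).
Local Notation mu := (@counting nat R).
Local Notation l2 := (l2 R).
Local Notation l2H := (l2_hilbert R).

Lemma counting_int_single (x : nat -> R) n : (forall k, k != n -> x k = 0) ->
  (\int[mu]_k (x k)%:E = (x n)%:E)%E.
Proof.
move=> x0; transitivity (\int[mu]_k (((cst (x n)%:E) \_ [set n]) k))%E.
  apply: eq_integral => k _; rewrite patchE; case: ifPn => /=.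
    by rewrite inE => ->.
  move=> kn; rewrite x0//; apply: contraNN kn => /eqP ->; exact/mem_set.
rewrite -integral_mkcond integral_cst//= /counting asboolT; last exact: finite_set1.
by rewrite fset_set1 finmap.cardfs1 mule1.
Qed.

Lemma delta_subproof n : (fun k : nat => (k == n)%:R : R[i]) \in @l2_pred R.
Proof.
apply/l2_predE; rewrite /square_integrable (@counting_int_single _ n) ?ltry//.
by move=> k /negbTE ->; rewrite sqmod0.
Qed.

Definition delta n : l2H := L2 (delta_subproof n).

Lemma deltaE n k : (delta n : l2) k = (k == n)%:R. Proof. by []. Qed.

Lemma hdot_delta n (f : l2H) : hdot l2H (delta n) f = ((f : l2) n)^*.
Proof.
apply: complex_ext; rewrite /= /l2dot /cintegral /= /Rintegral.
  rewrite (@counting_int_single _ n) /=; first by rewrite eqxx mul1r.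
  by move=> k /negbTE ->; rewrite mul0r.
rewrite (@counting_int_single _ n) /=; first by rewrite eqxx mul1r.
by move=> k /negbTE ->; rewrite mul0r.
Qed.

Lemma hdot_deltar n (f : l2H) : hdot l2H f (delta n) = (f : l2) n.
Proof. by rewrite hdotC hdot_delta conjCK. Qed.

Lemma hdot_deltas n m : hdot l2H (delta n) (delta m) = (n == m)%:R.
Proof. by rewrite hdot_delta deltaE eq_sym rmorph_nat. Qed.

Lemma l2_hsqnormE (f : l2) : hsqnorm (f : l2H) = l2sqnorm f.
Proof. by rewrite /hsqnorm (l2dotE f : hdot l2H f f = _). Qed.

(** Both operators have adjoints, and the coordinates of the adjoints are
inner products with the images of the basis vectors. *)
Lemma bounded_l2_ext K (S T : l2H -> K) :
  bounded_linear S -> bounded_linear T ->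
  (forall n, S (delta n) = T (delta n)) -> forall f, S f = T f.
Proof.
move=> bS bT ST f; apply: hdot_inj => z.
have [S' SP] := adjoint_exists bS; have [T' TP] := adjoint_exists bT.
rewrite hdotC [RHS]hdotC SP TP; congr (hdot _ _ _)^*.
apply: (@l2_eq _ (S' z : l2) (T' z)) => n.
by apply: (can_inj (@conjCK _)); rewrite -!hdot_delta -SP -TP ST.
Qed.

Lemma square_integrable_sums (u : nat -> R[i]) (M : R) :
  (forall N, \sum_(0 <= k < N) sqmod (u k) <= M) ->
  (\int[mu]_n (sqmod (u n))%:E <= M%:E)%E.
Proof.
move=> uM; rewrite intmuE; last by move=> k; exact: sqmod_ge0.
apply: lime_le; first by apply: is_cvg_nneseries => k _ _; rewrite lee_fin sqmod_ge0.
by apply: nearW => N; rewrite sumEFin lee_fin.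
Qed.

Section OrthonormalSequence.
Variables (K : hilbert R) (u : nat -> K).
Hypothesis u_orthonormal : forall n m, hdot K (u n) (u m) = (n == m)%:R.

(* Bessel's inequality, with the defect made explicit. *)
Let bessel_finite y N : \sum_(0 <= k < N) sqmod (hdot K y (u k)) =
  hsqnorm y - hsqnorm (y - \sum_(0 <= k < N) hdot K y (u k) *: u k).
Proof.
elim: N => [|N IH]; first by rewrite !big_geq// subr0 subrr.
rewrite !big_nat_recr//= IH; set p := \sum_(_ <= _ < _) _.
have pu : hdot K p (u N) = 0.
  rewrite /p hdot_suml big_nat big1// => k /andP[_ kN].
  by rewrite hdotZl u_orthonormal (ltn_eqF kN) mulr0.
rewrite opprD addrA -scaleNr [in RHS]hsqnormD hsqnormZ hdotZr hdotBl pu subr0.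
have -> : hsqnorm (u N) = 1 by rewrite /hsqnorm u_orthonormal eqxx.
rewrite !sqmodE rmorphN/= conjCE; case: (hdot K y (u N)) => a b /=.
by ring.
Qed.

Let coefficients_subproof y :
  (fun n => hdot K y (u n)) \in @l2_pred R.
Proof.
apply/l2_predE; apply: le_lt_trans (ltry (hsqnorm y)).
apply: square_integrable_sums => N.
by rewrite bessel_finite gerDl oppr_le0 hsqnorm_ge0.
Qed.

Let coefficients y : l2H := L2 (coefficients_subproof y).

Let bounded_coefficients : bounded_linear coefficients.
Proof.
split.
  move=> a x y; apply: (@l2_eq _ (coefficients _ : l2) _) => n.
  by rewrite l2D l2Z /= hdotDl hdotZl.
exists 1 => y; rewrite mul1r l2_hsqnormE -lee_fin l2sqnormE.
apply: square_integrable_sums => N.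
by rewrite bessel_finite gerDl oppr_le0 hsqnorm_ge0.
Qed.

(** The isometry sends f to the sum of the f n *: u n.  It is obtained as the
adjoint of the map taking y to its coefficients, which is bounded by Bessel's
inequality; this avoids proving that the series converges. *)
Lemma orthonormal_isometry : exists V : l2H -> K,
  [/\ bounded_linear V, (forall f, `|V f| = `|f|) & forall n, V (delta n) = u n].
Proof.
have [V VP] := adjoint_exists bounded_coefficients.
have bV := bounded_linear_adjoint bounded_coefficients VP.
exists V; split=> //.
  move=> f; apply/eqP; rewrite -(@eqrXn2 _ 2)// !hnormE; apply/eqP.
  rewrite -VP; congr (hdot _ _ f); apply: (@l2_eq _ (coefficients _ : l2) f) => n /=.
  have cu : coefficients (u n) = delta n.
    by apply: (@l2_eq _ (coefficients _ : l2) _) => k; rewrite /= u_orthonormal eq_sym.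
  by rewrite hdotC -VP cu -hdotC hdot_deltar.
by move=> n; apply: hdot_inj => z; rewrite -VP hdot_deltar.
Qed.

End OrthonormalSequence.

Section WeightedComposition.
Variables (psi : nat -> nat) (u : nat -> R[i]) (M : R).
Hypothesis u_bounded : forall n, sqmod (u n) <= M.
Hypothesis psi_inj : forall i j, u i != 0 -> u j != 0 -> psi i = psi j -> i = j.

(* The composition is injective where the weight does not vanish, so every
   coordinate of f is used at most once. *)
Let wco_int (f : l2) : (\int[mu]_n (sqmod (u n * f (psi n)))%:E <=
  (M * l2sqnorm f)%:E)%E.
Proof.
have M0 : 0 <= M by exact: le_trans (sqmod_ge0 (u 0)) (u_bounded 0).
have -> : ((M * l2sqnorm f)%:E = \int[mu]_n (M%:E * (sqmod (f n))%:E))%E.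
  rewrite EFinM l2sqnormE ge0_integralZl// => n _.
  by rewrite lee_fin sqmod_ge0.
rewrite !counting_int_esum; last 2 first.
- by move=> k; rewrite mule_ge0 ?lee_fin ?sqmod_ge0.
- by move=> k; rewrite lee_fin sqmod_ge0.
pose D := [set n | u n != 0].
pose a n := (M%:E * (sqmod (f n))%:E)%E.
have a0 n : (0 <= a n)%E by rewrite mule_ge0 ?lee_fin ?sqmod_ge0.
apply: (@le_trans _ _ (\esum_(n in D) a (psi n))%E).
  rewrite (esum_mkcond D); apply: le_esum => n _; case: ifPn.
    by rewrite inE => _; rewrite /a -EFinM lee_fin sqmodM ler_wpM2r ?sqmod_ge0.
  move=> /negP nD; rewrite lee_fin; have [->|un] := eqVneq (u n) 0.
    by rewrite mul0r sqmod0.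
  by case: nD; exact/mem_set.
rewrite -(esum_image D psi a); last first.
  by move=> i j /set_mem/= ui /set_mem/= uj; exact: psi_inj.
rewrite (esum_mkcond (psi @` D)); apply: le_esum => n _.
by case: ifPn => _ //; exact: a0.
Qed.

Lemma wco_everywhere f : wco_domain psi u f.
Proof. by apply: le_lt_trans (wco_int f) (ltry _). Qed.

Lemma bounded_wco : bounded_linear (wco psi u).
Proof.
split.
  move=> a x y; apply: (@l2_eq _ (wco _ _ _ : l2) _) => n.
  rewrite l2D l2Z !wcoE; [|exact: wco_everywhere..].
  by rewrite l2D l2Z mulrDr mulrCA.
exists M => f; rewrite !l2_hsqnormE -lee_fin l2sqnormE.
apply: le_trans (wco_int f); apply: ge0_le_integral => //=.
- by move=> n _; rewrite lee_fin sqmod_ge0.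
- by move=> n _; rewrite lee_fin wcoE//; exact: wco_everywhere.
Qed.

End WeightedComposition.
End SquareSummable.
Arguments delta {R} n%_N.
(** * The weights of a 2-isometry and its Cauchy dual *)

Section TwoIsometricWeights.
Variables (R : realType) (phi : nat -> nat) (w : nat -> R[i]).
Hypothesis phi0 : phi 0%N = 0%N.
Hypothesis phiS : forall n : nat, phi n.+1 = n.
Hypothesis C_everywhere : wco_domain phi w = setT.
Hypothesis C_two_isometry : two_isometry (wco phi w).
Local Notation l2 := (l2 R).
Local Notation l2H := (l2_hilbert R).
Local Notation C := (wco phi w).

Let a n : R := sqmod (w n).
Let c : R := a 2 - 1.

Let bC : bounded_linear C.
Proof. by apply/bounded_operatorP; case: C_two_isometry. Qed.

Let C_coord (f : l2) n : (C f : l2) n = w n * f (phi n).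
Proof. by apply: wcoE; rewrite C_everywhere. Qed.

Let C_delta0 : C (delta 0) = w 0 *: delta 0 + w 1 *: delta 1.
Proof.
apply: (@l2_eq _ (C _ : l2) (_ : l2)) => n.
rewrite C_coord l2D !l2Z !deltaE; case: n => [|[|n]]; rewrite ?phi0 ?phiS /=;
  by rewrite ?(mulr1, mulr0, addr0, add0r).
Qed.

Let C_deltaS n : C (delta n.+1) = w n.+2 *: delta n.+2.
Proof.
apply: (@l2_eq _ (C _ : l2) (_ : l2)) => m.
rewrite C_coord l2Z !deltaE; case: m => [|m]; rewrite ?phi0 ?phiS /= ?mulr0//.
by rewrite eqSS; case: eqVneq => [->|]; rewrite ?mulr0.
Qed.

(* The operator identity tested against f itself. *)
Let two_isometry_norm f : hsqnorm f - 2 * hsqnorm (C f) + hsqnorm (C (C f)) = 0.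
Proof.
have [_ /(_ f) /(congr1 (hdot l2H f))] := C_two_isometry.
rewrite linear0r hdotDr hdotBr hdotZr -!hdot_adjoint// !hsqnormE.
have -> : (2%:R : R[i])^* = (2%:R : R)%:C%C by rewrite conjCE conjc_nat rmorph_nat.
by rewrite -rmorphM -rmorphB -rmorphD => /complexI.
Qed.

Let hsqnorm_delta n : hsqnorm (delta n : l2H) = 1.
Proof. by rewrite /hsqnorm hdot_deltas eqxx. Qed.

(** The 2-isometry identity at a basis vector beyond the first. *)
Lemma weight_rec n : 1 - 2 * a n.+2 + a n.+2 * a n.+3 = 0.
Proof.
have := two_isometry_norm (delta n.+1).
rewrite C_deltaS (linear_mapZ _ _ bC.1) C_deltaS !hsqnormZ !hsqnorm_delta.
by rewrite !mulr1.
Qed.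

Let hsqnorm_three_deltas (x y z : R[i]) i j k : i != j -> i != k -> j != k ->
  hsqnorm (x *: delta i + y *: delta j + z *: delta k) =
  sqmod x + sqmod y + sqmod z.
Proof.
move=> ij ik jk; rewrite !hsqnormD !hsqnormZ !hsqnorm_delta !hdotDl !hdotZl !hdotZr.
rewrite !hdot_deltas (negbTE ij) (negbTE ik) (negbTE jk) !mulr0 !addr0 !mulr1.
by rewrite mulr0 !addr0.
Qed.

(** The 2-isometry identity at the first basis vector. *)
Lemma weight_initial : 1 - 2 * alpha w + a 0 * alpha w + a 1 * a 2 = 0.
Proof.
have := two_isometry_norm (delta 0).
have -> : C (C (delta 0)) =
    (w 0 * w 0) *: delta 0 + (w 0 * w 1) *: delta 1 + (w 1 * w 2) *: delta 2.
  rewrite C_delta0 (linear_mapD _ _ bC.1) !(linear_mapZ _ _ bC.1) C_delta0 C_deltaS.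
  by rewrite scalerDr !scalerA.
have -> : C (delta 0) = w 0 *: delta 0 + w 1 *: delta 1 + 0 *: delta 2.
  by rewrite C_delta0 scale0r addr0.
rewrite !hsqnorm_three_deltas// hsqnorm_delta !sqmodM sqmod0 /alpha -!/(a _) => <-.
by ring.
Qed.

(** For a 2-isometry the squared norms of the iterates of a vector form an
arithmetic progression; here the vector is delta 1. *)
Lemma weight_prod_linear n : \prod_(i < n) a i.+2 = 1 + n%:R * c.
Proof.
elim: n {-2}n (leqnn n) => [|N IH] n; first by rewrite leqn0 => /eqP ->; rewrite big_ord0 mul0r addr0.
case: n => [|[|n]] le_n; first by rewrite big_ord0 mul0r addr0.
  by rewrite big_ord1 /c; ring.
rewrite !big_ord_recr /= -mulrA.
have := IH n (leq_trans (leqnSn _) le_n); have := IH n.+1 le_n.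
rewrite big_ord_recr /=; move: (\prod_(i < n) _) => P; have := weight_rec n.
move: (a n.+2) (a n.+3) => x y xy Px PE.
have -> : x * y = 2 * x - 1 by lra.
rewrite -!natr1 in Px *.
by rewrite mulrBr mulr1 mulrCA Px PE; ring.
Qed.

Let linear_ge0 n : 0 <= 1 + n%:R * c.
Proof. by rewrite -weight_prod_linear prodr_ge0// => i _; exact: sqmod_ge0. Qed.

(** Otherwise the arithmetic progression of squared norms would become
negative. *)
Lemma weight_c_ge0 : 0 <= c.
Proof.
rewrite leNgt; apply/negP => c0.
have := linear_ge0 (Num.truncn (- c^-1)).+1.
have : - c^-1 < (Num.truncn (- c^-1)).+1%:R by exact: truncnS_gt.
move: (_%:R) => N lt; have : N * c < - c^-1 * c by rewrite ltr_nM2r.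
by rewrite mulNr mulVf ?lt_eqF// => ? ?; lra.
Qed.

Let linear_gt0 n : 0 < 1 + n%:R * c.
Proof. by rewrite ltr_wpDr// mulr_ge0// weight_c_ge0. Qed.

Lemma weight_ratio n : a n.+2 = (1 + n.+1%:R * c) / (1 + n%:R * c).
Proof.
by rewrite -!weight_prod_linear big_ord_recr/= mulrC mulKf// weight_prod_linear gt_eqF// linear_gt0.
Qed.

Lemma weight_ge1 n : 1 <= a n.+2.
Proof.
rewrite weight_ratio ler_pdivlMr// mul1r lerD2l.
by rewrite ler_wpM2r ?weight_c_ge0// ler_nat.
Qed.

(** Factored form of the identity at the first basis vector.  It forces
alpha >= 1, gives |w 0| = 1 when w 1 = 0, and gives alpha c = alpha - 1 when
w 0 = 0. *)
Lemma weight_relation : a 1 * c = (1 - a 0) * (alpha w - 1).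
Proof.
have := weight_initial; rewrite /alpha -!/(a _) /c.
by move: (a 0) (a 1) (a 2) => x y z E; nra.
Qed.

Lemma alpha_ge1 : 1 <= alpha w.
Proof.
rewrite leNgt; apply/negP => lt; have := weight_relation; have := weight_c_ge0.
move: lt (sqmod_ge0 (w 0)) (sqmod_ge0 (w 1)); rewrite /alpha -!/(a _).
move: (a 0) (a 1) c => x y z *; nra.
Qed.

(** The diagonal entries of C^* C. *)
Definition gram_weight n : R := if n is 0%N then alpha w else a n.+1.

Lemma gram_weight_ge1 n : 1 <= gram_weight n.
Proof. by case: n => [|n] /=; [exact: alpha_ge1|exact: weight_ge1]. Qed.

Lemma gram_diagonal (f : l2H) n :
  (adjoint C (C f) : l2) n = (gram_weight n)%:C%C * (f : l2) n.
Proof.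
apply: (can_inj (@conjCK _)); rewrite -hdot_delta -hdot_adjoint//.
have -> : ((gram_weight n)%:C%C * (f : l2) n)^* = (gram_weight n)%:C%C * ((f : l2) n)^*.
  by rewrite rmorphM /= conj_real.
case: n => [|n].
  rewrite C_delta0 hdotDl !hdotZl !hdot_delta !C_coord phi0 phiS !rmorphM /alpha.
  by rewrite rmorphD /= !sqmodC !normCK mulrDl !mulrA.
by rewrite C_deltaS hdotZl hdot_delta C_coord phiS rmorphM/= /a sqmodC normCK !mulrA.
Qed.

Let gram_inv (f : l2H) : l2H :=
  wco id (fun n => ((gram_weight n)^-1)%:C%C) f.

Let gram_inv_bound n : sqmod (((gram_weight n)^-1)%:C%C : R[i]) <= 1.
Proof.
rewrite sqmod_real exprVn invf_le1 ?exprn_ege1 ?exprn_gt0 ?gram_weight_ge1//.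
by apply: lt_le_trans (gram_weight_ge1 n).
Qed.

Let bounded_gram_inv : bounded_linear gram_inv.
Proof. by apply: (bounded_wco gram_inv_bound) => i j _ _. Qed.

Let gram_weight_neq0 n : (gram_weight n)%:C%C != 0 :> R[i].
Proof.
rewrite fmorph_eq0 gt_eqF//; exact: lt_le_trans (gram_weight_ge1 n).
Qed.

Let gram_invE (f : l2) n :
  (gram_inv f : l2) n = f n / (gram_weight n)%:C%C.
Proof.
rewrite wcoE; last by apply: (wco_everywhere gram_inv_bound) => i j _ _.
by rewrite mulrC fmorphV.
Qed.

(** The operator C^* C is diagonal with entries at least 1, so the choice made
in the Cauchy dual is forced. *)
Lemma cauchy_dualE f : cauchy_dual C f = C (gram_inv f).
Proof.
rewrite /cauchy_dual; congr C; case: xgetP => [g _ gP|/(_ (gram_inv f)) []].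
  apply: (@l2_eq _ (g : l2) (gram_inv f : l2)) => n.
  rewrite gram_invE; apply: (mulIf (gram_weight_neq0 n)); rewrite divfK// mulrC.
  by rewrite -gram_diagonal gP.
apply: (@l2_eq _ (adjoint C (C (gram_inv f)) : l2) (f : l2)) => n.
by rewrite gram_diagonal gram_invE mulrC divfK.
Qed.

Lemma bounded_cauchy_dual : bounded_linear (cauchy_dual C).
Proof.
have [lin [M bM]] := bounded_linear_comp bC bounded_gram_inv.
split; first by move=> x f g; rewrite !cauchy_dualE; exact: lin.
by exists M => f; rewrite cauchy_dualE; exact: bM.
Qed.

Let gram_inv_delta n : gram_inv (delta n) = ((gram_weight n)^-1)%:C%C *: delta n.
Proof.
apply: (@l2_eq _ (gram_inv _ : l2) (_ : l2)) => k.
rewrite gram_invE l2Z deltaE; case: eqVneq => [->|_].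
  by rewrite mul1r mulr1 fmorphV.
by rewrite mul0r mulr0.
Qed.

Lemma cauchy_dual_delta0 : cauchy_dual C (delta 0) =
  (w 0 / (alpha w)%:C%C) *: delta 0 + (w 1 / (alpha w)%:C%C) *: delta 1.
Proof.
rewrite cauchy_dualE gram_inv_delta (linear_mapZ _ _ bC.1) C_delta0 scalerDr !scalerA.
by rewrite /= fmorphV !(mulrC (_^-1)).
Qed.

(** On the span of the basis vectors beyond the first, the Cauchy dual is a
weighted shift with these weights. *)
Definition dual_shift_weight n : R[i] := w n.+2 / (a n.+2)%:C%C.

Lemma cauchy_dual_deltaS n : cauchy_dual C (delta n.+1) =
  dual_shift_weight n *: delta n.+2.
Proof.
rewrite cauchy_dualE gram_inv_delta (linear_mapZ _ _ bC.1) C_deltaS !scalerA.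
by rewrite /= fmorphV mulrC.
Qed.

Lemma dual_shift_prod n :
  \prod_(i < n) sqmod (dual_shift_weight i) = (1 + n%:R * c)^-1.
Proof.
rewrite -weight_prod_linear -prodfV; apply: eq_bigr => i _.
rewrite /dual_shift_weight sqmod_divr -/(a _) expr2 invfM mulrA divff ?mul1r//.
by rewrite gt_eqF// (lt_le_trans _ (weight_ge1 i)).
Qed.

Lemma dual_coordinate (f : l2) n :
  (cauchy_dual C f : l2) n = w n * (f (phi n) / (gram_weight (phi n))%:C%C).
Proof. by rewrite cauchy_dualE C_coord gram_invE. Qed.

End TwoIsometricWeights.
(** * The Radon-Nikodym derivatives at 0 *)

Section MomentFormula.
Variable R : realType.

(** The sequence of the second part of the theorem, in the parameters
s = |w 0|^2 / alpha^2, Q = |w 1|^2 / alpha^2 and c = |w 2|^2 - 1.  It starts at 1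
and is best understood through its recurrence. *)
Definition defect_moment (s Q c : R) (n : nat) : R :=
  s ^+ n + \sum_(j < n) s ^+ (n - j - 1) * Q / (1 + j%:R * c).

Lemma defect_moment0 s Q c : defect_moment s Q c 0 = 1.
Proof. by rewrite /defect_moment big_ord0 expr0 addr0. Qed.

Lemma defect_momentS s Q c n : defect_moment s Q c n.+1 =
  s * defect_moment s Q c n + Q / (1 + n%:R * c).
Proof.
rewrite /defect_moment big_ord_recr/= subSnn subnn expr0 mul1r exprS mulrDr addrA.
congr (_ + _ + _); rewrite mulr_sumr; apply: eq_bigr => j _.
have -> : (n.+1 - j - 1 = (n - j - 1).+1)%N by have := ltn_ord j; lia.
by rewrite exprS !mulrA.
Qed.

(** When the fibre over k lies below N, the derivative at k is a finite sum. *)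
Lemma RN_derivative_finite psi (u : nat -> R[i]) k N :
  (forall j, psi j = k -> (j < N)%N) ->
  RN_derivative psi u k = (\sum_(j < N | psi j == k) sqmod (u j))%:E.
Proof.
move=> psiN; rewrite RN_derivativeE.
rewrite (_ : psi @^-1` [set k] = `I_N `&` (psi @^-1` [set k])); last first.
  by apply/seteqP; split => [j /= jk|j /= []//]; split => //; exact: psiN.
rewrite esum_mkcondr esum_fset//; last by move=> j _; case: ifPn; rewrite ?lee_fin ?sqmod_ge0.
rewrite -fsbig_ord [in RHS]big_mkcond -sumEFin; apply: eq_bigr => j _.
have [jk|jk] := eqVneq (psi j) k; first by rewrite mem_set.
by case: ifPn => // /set_mem /= /eqP; rewrite (negbTE jk).
Qed.

Variables (phi : nat -> nat) (w : nat -> R[i]).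
Hypothesis phi0 : phi 0%N = 0%N.
Hypothesis phiS : forall n : nat, phi n.+1 = n.

Lemma iter_phi n j : iter n phi j = (j - n)%N.
Proof.
by elim: n => [|n IH]; rewrite ?subn0//= IH subnS; case: (j - n)%N.
Qed.

Lemma RN_derivative_phi k : RN_derivative phi w k = (gram_weight w k)%:E.
Proof.
rewrite (@RN_derivative_finite _ _ _ k.+2); last first.
  by case=> [|j]; rewrite ?phi0 ?phiS => // ->.
congr EFin; case: k => [|k].
  by rewrite big_mkcond !big_ord_recr big_ord0 /= phi0 phiS eqxx add0r.
rewrite big_mkcond big_ord_recr/= phiS eqxx big1 ?add0r// => j _.
case: ifPn => // /eqP; case: j => -[|j] /= jk; rewrite ?phi0 ?phiS => // E.
by move: jk; rewrite E ltnn.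
Qed.

Hypothesis C_everywhere : wco_domain phi w = setT.
Hypothesis C_two_isometry : two_isometry (wco phi w).

Local Notation a n := (sqmod (w n)).

Lemma sqmod_dual_weight n :
  sqmod (dual_weight phi w n) = a n / gram_weight w (phi n) ^+ 2.
Proof.
rewrite /dual_weight; case: eqVneq => [->|_]; first by rewrite sqmod0 mul0r.
by rewrite RN_derivative_phi sqmod_divr.
Qed.

Let s := a 0 / alpha w ^+ 2.
Let Q := a 1 / alpha w ^+ 2.
Let c := a 2 - 1.

Let d n := sqmod (dual_weight phi w n).

Let d0 : d 0 = s. Proof. by rewrite /d sqmod_dual_weight phi0. Qed.

Let d1 : d 1 = Q. Proof. by rewrite /d sqmod_dual_weight phiS. Qed.

Let prod_d n : \prod_(i < n) d i.+2 = (1 + n%:R * c)^-1.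
Proof.
rewrite -(weight_prod_linear phi0 phiS C_everywhere C_two_isometry) -prodfV.
apply: eq_bigr => i _; rewrite /d sqmod_dual_weight phiS /=.
have ai := weight_ge1 phi0 phiS C_everywhere C_two_isometry i.
by rewrite expr2 invfM mulrA divff ?mul1r// gt_eqF// (lt_le_trans _ ai).
Qed.

(* The orbit of j + 1 meets the weights j + 1, ..., 2, which telescope, then the
   weight at 1 once, then stays at 0. *)
Let tail_product n j : (j < n)%N ->
  \prod_(i < n) d (j.+1 - i) = s ^+ (n - j - 1) * Q / (1 + j%:R * c).
Proof.
elim: n => // n IH; rewrite ltnS leq_eqVlt => /orP[/eqP ->|jn]; last first.
  rewrite big_ord_recr/= IH// (eqP (_ : j.+1 - n == 0)%N) ?subn_eq0// d0.
  have -> : (n.+1 - j - 1 = (n - j - 1).+1)%N by lia.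
  by rewrite exprS; ring.
have n1 : (n.+1 - n = 1)%N by lia.
rewrite big_ord_recr/= n1 d1 subnn expr0 mul1r mulrC; congr (_ * _).
rewrite -prod_d (reindex_inj rev_ord_inj); apply: eq_bigr => i _ /=.
by congr (d _); have := ltn_ord i; lia.
Qed.

Lemma RN_derivative_iterate n :
  RN_derivative (iter n phi) (weight_prod phi (dual_weight phi w) n) 0%N =
  (defect_moment s Q c n)%:E.
Proof.
rewrite (@RN_derivative_finite _ _ _ n.+1); last first.
  by move=> j; rewrite iter_phi => /eqP; rewrite subn_eq0.
have sqmod_prod m j : sqmod (weight_prod phi (dual_weight phi w) m j) =
    \prod_(i < m) d (j - i).
  by rewrite /weight_prod sqmod_prod; apply: eq_bigr => i _; rewrite iter_phi.
congr EFin; rewrite (eq_bigl xpredT); last first.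
  by move=> j; rewrite iter_phi subn_eq0 -ltnS ltn_ord.
rewrite big_ord_recl sqmod_prod; congr (_ + _).
  by under eq_bigr do rewrite sub0n d0; rewrite prodr_const card_ord.
by apply: eq_bigr => j _; rewrite sqmod_prod tail_product.
Qed.

Lemma defect_moment_closed_form n : defect_moment s Q c n =
  Normc.normc (w 0%N) ^+ (2 * n) / alpha w ^+ (2 * n) +
    \sum_(j < n)
      Normc.normc (w 0%N) ^+ (2 * (n - j - 1)) * Normc.normc (w 1%N) ^+ 2 /
      (alpha w ^+ (2 * (n - j)) *
       (1 + j%:R * (Normc.normc (w 2%N) ^+ 2 - 1))).
Proof.
have al0 : alpha w != 0.
  rewrite gt_eqF// (lt_le_trans _ (alpha_ge1 phi0 phiS C_everywhere C_two_isometry))//.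
rewrite /defect_moment !exprM -expr_div_n; congr (_ + _); apply: eq_bigr => j _.
rewrite !exprM -!/(sqmod _) -/c /s /Q expr_div_n.
have -> : (n - j = (n - j - 1).+1)%N by have := ltn_ord j; lia.
rewrite subSS subn0 [(alpha w ^+ 2) ^+ _.+1]exprS !invfM; ring.
Qed.

End MomentFormula.
(** * Failure of positivity *)

Section NegativeDifferences.
Variable R : realType.
Implicit Types (g f : nat -> R) (s Q c : R).

(** If g is the sequence of moments of a measure m, then descent g is that of
(1 - t) m and shift_sub s g that of (t - s) m. *)
Definition descent g j : R := g j - g j.+1.
Definition shift_sub s g j : R := g j.+1 - s * g j.

Lemma iter_descent_shift_sub s Q f m :
  iter m descent (fun j => Q * shift_sub s f j) =
  (fun j => Q * shift_sub s (iter m descent f) j).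
Proof.
elim: m => //= m ->; apply/funext => j; rewrite /descent /shift_sub; ring.
Qed.

(** These are the values of the Beta integrals of t^j (1 - t)^m against the
measure with moments 1 / (1 + n c). *)
Lemma iter_descent_harmonic c m j : 0 <= c ->
  iter m descent (fun k => (1 + k%:R * c)^-1) j =
  m`!%:R * c ^+ m / \prod_(i < m.+1) (1 + (j + i)%:R * c).
Proof.
move=> c0.
have nz k : 1 + k%:R * c != 0 by rewrite gt_eqF// ltr_wpDr// mulr_ge0.
elim: m j => [|m IH] j; first by rewrite big_ord1 addn0 fact0 expr0 !mul1r.
rewrite iterS {1}/descent !IH.
rewrite [in RHS]big_ord_recl big_ord_recl /= addn0.
have -> : \prod_(i < m) (1 + (j + bump 0 i)%:R * c) = \prod_(i < m) (1 + (j.+1 + i)%:R * c).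
  by apply: eq_bigr => i _; rewrite addSnnS.
rewrite [in RHS](eq_bigr (fun i : 'I_m.+1 => 1 + (j.+1 + i)%:R * c)); last first.
  by move=> i _; rewrite addSnnS.
rewrite !big_ord_recr /= factS natrM exprS.
have := nz j; have := nz (j.+1 + m)%N.
have : \prod_(i < m) (1 + (j.+1 + i)%:R * c) != 0 by apply/prodf_neq0 => i _.
move: (\prod_(_ < _) _) (m`!%:R) => P F P0.
have -> : (j.+1 + m)%:R = j%:R + m%:R + 1 :> R by rewrite natrD -natr1; ring.
rewrite -natr1 => ? ?; field.
by apply/and3P.
Qed.

(** Write L for the functional sending t^n to the n-th term.  The recurrence
says that L ((t - s) f) is Q times the integral of f against the measure with
moments 1 / (1 + n c), which charges the interval from 0 to s.  Taking
f = (t - s) (1 - t)^(2m) with m large concentrates the integral near 0, where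
t - s is negative, although the argument (t - s)^2 (1 - t)^(2m) of L is a
square. *)
Lemma defect_moment_not_positive s Q c : 0 < s -> 0 < Q -> 0 < c ->
  exists m, iter m.*2 descent (shift_sub s (shift_sub s (defect_moment s Q c))) 0%N < 0.
Proof.
move=> s0 Q0 c0.
have -> : shift_sub s (defect_moment s Q c) = fun j => Q * (1 + j%:R * c)^-1.
  by apply/funext => j; rewrite /shift_sub defect_momentS; ring.
have -> : shift_sub s (fun j => Q * (1 + j%:R * c)^-1) =
    fun j => Q * shift_sub s (fun k => (1 + k%:R * c)^-1) j.
  by apply/funext => j; rewrite /shift_sub; ring.
(* The sign is that of 1 / (1 + (2m + 1) c) - s. *)
pose m := (Num.truncn (s * c)^-1).+1; exists m.
have sm : 1 < s * (1 + m.*2.+1%:R * c).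
  have : (s * c)^-1 < m%:R by exact: truncnS_gt.
  rewrite invf_plt ?posrE ?mulr_gt0// -[ltLHS]mul1r ltr_pdivrMr// => h.
  apply: lt_le_trans h _; rewrite -mulrA ler_wpM2l ?ltW// mulrC.
  have : m%:R * c <= m.*2.+1%:R * c.
    by apply: ler_wpM2r; [exact: ltW|rewrite ler_nat; lia].
  by move=> ?; lra.
move: (m.*2) sm => k sm.
rewrite iter_descent_shift_sub pmulr_rlt0// /shift_sub !iter_descent_harmonic ?ltW//.
have gt0 n : 0 < 1 + n%:R * c by rewrite ltr_wpDr// mulr_ge0// ltW.
rewrite big_ord_recr [in X in _ - X]big_ord_recl /= addn0 mul0r addr0 mul1r.
under [in X in _ - X]eq_bigr do rewrite /bump /= add1n add0n -add1n.
have : 0 < \prod_(i < k) (1 + (1 + i)%:R * c) by rewrite prodr_gt0.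
have : 0 < k`!%:R * c ^+ k by rewrite mulr_gt0 ?exprn_gt0// ltr0n fact_gt0.
have := gt0 k.+1; rewrite add1n; move: sm.
move: (\prod_(_ < _) _) (_ * _ ^+ _) (1 + k.+1%:R * c) => P F x sx x0 F0 P0.
rewrite (_ : _ - _ = F / P * ((1 - s * x) / x)); last by field; rewrite !gt_eqF.
by rewrite pmulr_rlt0 ?divr_gt0// pmulr_llt0 ?invr_gt0// subr_lt0.
Qed.

End NegativeDifferences.
(** * Normal extensions give positive differences *)

Section NormalMoments.
Variables (R : realType) (K : hilbert R) (N : K -> K).
Hypothesis N_normal : normal_operator N.

Let A (x : K) := adjoint N (N x).

Let bN : bounded_linear N.
Proof. by apply/bounded_operatorP; case: N_normal. Qed.

(** Normality lets the powers of N and of its adjoint be separated. *)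
Lemma hdot_iter_modulus j x y :
  hdot K (iter j A x) y = hdot K (iter j N x) (iter j N y).
Proof.
have NA i z : N (iter i A z) = iter i A (N z).
  by elim: i => //= i <-; rewrite [in RHS]/A N_normal.2.
elim: j x y => // j IH x y; rewrite iterS hdot_adjoint_l// NA IH.
by rewrite -!iterSr.
Qed.

(** The sequences of moments of the positive operator A at a vector.  They are
moment sequences on a half-line by the spectral theorem, of which only the
stability below under multiplication by squares is used. *)
Definition modulus_moment (g : nat -> R) : Prop :=
  exists x, forall j, hdot K (iter j A x) x = (g j)%:C%C.

Let A_linear : linear A.
Proof.
have [S NS] := adjoint_exists bN.
have SE : adjoint N = S by apply/funext => y; apply: adjointE.
have bS := bounded_linear_adjoint bN NS.
by have [] := bounded_linear_comp bS bN; rewrite /A SE.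
Qed.

(** Replacing the vector x by A x - s x multiplies the measure by (t - s)^2. *)
Lemma modulus_moment_shift_sub g s :
  modulus_moment g -> modulus_moment (shift_sub s (shift_sub s g)).
Proof.
move=> [x gx]; exists (A x - s%:C%C *: x) => j.
rewrite (linear_mapB _ _ (linear_iter j A_linear)) (linear_mapZ _ _ (linear_iter j A_linear)).
have symA z : hdot K z (A x) = hdot K (A z) x.
  by rewrite /A -hdot_adjoint// hdot_adjoint_l.
rewrite !hdotBl !hdotBr !hdotZl !hdotZr !symA -!iterS -!iterSr !gx.
by rewrite conj_real /shift_sub !(rmorphB, rmorphM)/= mulrBr.
Qed.

(** Two descents are the case s = 1; an even number is required because A need
not be a contraction. *)
Lemma modulus_moment_descent g m :
  modulus_moment g -> modulus_moment (iter m.*2 (@descent R) g).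
Proof.
move=> gP; elim: m => // m IH; rewrite doubleS !iterS.
rewrite (_ : descent (descent _) = shift_sub 1 (shift_sub 1 (iter m.*2 (@descent R) g))).
  exact: modulus_moment_shift_sub.
by apply/funext => j; rewrite /descent /shift_sub; ring.
Qed.

Lemma modulus_moment_ge0 g : modulus_moment g -> 0 <= g 0.
Proof. by move=> [x /(_ 0%N)/= gx]; rewrite -ler0c -gx dnorm_ge0. Qed.

End NormalMoments.

Section PerturbedShift.
Variables (R : realType) (S : l2_hilbert R -> l2_hilbert R).
Variables (p q : R[i]) (v : nat -> R[i]) (c : R).
Local Notation l2 := (l2 R).
Local Notation l2H := (l2_hilbert R).
Hypothesis bS : bounded_linear S.
Hypothesis S_delta0 : S (delta 0) = p *: delta 0 + q *: delta 1.
Hypothesis S_deltaS : forall n, S (delta n.+1) = v n *: delta n.+2.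
Hypothesis S_support : forall (f : l2H) n, (f : l2) n = 0 -> (S f : l2) n.+1 = 0.
Hypothesis v_prod : forall n, \prod_(i < n) sqmod (v i) = (1 + n%:R * c)^-1.

Lemma iter_S_delta1 n : iter n S (delta 1) = (\prod_(i < n) v i) *: delta n.+1.
Proof.
elim: n => [|n IH]; first by rewrite big_ord0 scale1r.
by rewrite iterS IH (linear_mapZ _ _ bS.1) S_deltaS scalerA big_ord_recr.
Qed.

(** The vectors obtained by iterating S from delta 0 and from delta 1 are
orthogonal, because the former have no coordinate beyond n. *)
Lemma hsqnorm_iter_S n :
  hsqnorm (iter n S (delta 0)) = defect_moment (sqmod p) (sqmod q) c n.
Proof.
elim: n => [|n IH]; first by rewrite defect_moment0 /hsqnorm hdot_deltas.
rewrite iterSr S_delta0 (linear_mapD _ _ (linear_iter n bS.1)).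
rewrite !(linear_mapZ _ _ (linear_iter n bS.1)) hsqnormD !hsqnormZ IH defect_momentS.
rewrite -addrA; congr (_ + _); rewrite iter_S_delta1 hsqnormZ {1}/hsqnorm hdot_deltas eqxx mulr1.
rewrite sqmod_prod v_prod !(hdotZl, hdotZr) hdot_deltar.
have -> : (iter n S (delta 0) : l2) n.+1 = 0.
  by elim: n {IH} => [|n IH]; [rewrite deltaE|rewrite iterS S_support].
by rewrite !mulr0 addr0.
Qed.

(** The squared norms of the iterates would be moments of the positive operator
of a normal extension, contradicting the failure of positivity. *)
Lemma perturbed_shift_not_subnormal :
  0 < c -> p != 0 -> q != 0 -> ~ subnormal S.
Proof.
have sqmod_gt0 (z : R[i]) : z != 0 -> 0 < sqmod z.
  by move=> z0; rewrite lt_neqAle sqmod_ge0 andbT eq_sym sqmod_eq0.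
move=> c0 p0 q0 [K [V [N [lV iV nN NV]]]].
have [m neg] := defect_moment_not_positive (sqmod_gt0 _ p0) (sqmod_gt0 _ q0) c0.
have iterNV j f : iter j N (V f) = V (iter j S f).
  by elim: j => //= j ->; rewrite NV.
have mom : modulus_moment N (defect_moment (sqmod p) (sqmod q) c).
  exists (V (delta 0)) => j; rewrite hdot_iter_modulus// !iterNV.
  by rewrite hdot_isometry// hsqnormE hsqnorm_iter_S.
have := modulus_moment_ge0 (modulus_moment_descent nN m (modulus_moment_shift_sub nN (sqmod p) mom)).
by rewrite leNgt neg.
Qed.

End PerturbedShift.
(** * A Jacobi matrix with harmonic moments *)

Section Jacobi.
Variables (R : realType) (kappa : R).
Hypothesis kappa_ge0 : 0 <= kappa.
Local Notation lin x := (1 + x * kappa).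

Let lin_gt0 (x : R) : 0 <= x -> 0 < lin x.
Proof. by move=> x0; rewrite ltr_wpDr// mulr_ge0. Qed.

(** The operator of multiplication by t on L^2 of the measure on the unit
interval with moments 1 / (1 + n kappa), whose density is a power of t, is
described in the basis of orthonormal polynomials, which are shifted Jacobi
polynomials.  Their recurrence coefficients are rational except for the factors
jacobi_root.  All formulas make sense for kappa = 0, where the measure is the
unit mass at 1. *)
Definition jacobi_root k : R := Num.sqrt (lin (2 * k%:R)).

Definition jacobi_link k : R :=
  k.+1%:R * kappa * lin k%:R / lin (2 * k%:R + 1).

Definition jacobi_off k : R :=
  jacobi_link k / (jacobi_root k * jacobi_root k.+1).

Definition jacobi_diag k : R :=
  lin k%:R ^+ 2 / (lin (2 * k%:R) * lin (2 * k%:R + 1)) +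
  (k%:R * kappa) ^+ 2 / (lin (2 * k%:R) * lin (2 * k%:R - 1)).

Definition jacobi_coef m k : R :=
  (m ^_ k)%:R * kappa ^+ k / \prod_(i < k.+1) lin (m + i)%:R.

(** The k-th coefficient of t^m in the orthonormal basis. *)
Definition jacobi_vector m k : R := jacobi_root k * jacobi_coef m k.

Lemma jacobi_root_gt0 k : 0 < jacobi_root k.
Proof. by rewrite sqrtr_gt0 lin_gt0// mulr_ge0. Qed.

Lemma jacobi_rootK k : jacobi_root k ^+ 2 = lin (2 * k%:R).
Proof. by rewrite sqr_sqrtr// ltW// lin_gt0// mulr_ge0. Qed.

Lemma jacobi_off_bound k : jacobi_off k ^+ 2 <= 1.
Proof.
rewrite /jacobi_off expr_div_n [(_ * jacobi_root _) ^+ 2]exprMn !jacobi_rootK /jacobi_link -natr1.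
have := mulr_ge0 (ler0n R k) kappa_ge0.
have -> : lin (2 * k%:R) = 1 + 2 * (k%:R * kappa) by ring.
have -> : lin (2 * (k%:R + 1)) = 1 + 2 * (k%:R * kappa) + 2 * kappa by ring.
have -> : lin (2 * k%:R + 1) = 1 + 2 * (k%:R * kappa) + kappa by ring.
rewrite mulrDl mul1r; move: (k%:R * kappa) => x x0; move: kappa kappa_ge0 => y y0.
have f1 : ((x + y) * (1 + x) / (1 + 2 * x + y)) ^+ 2 <= (1 + x) ^+ 2.
  rewrite mulrAC exprMn ler_piMl ?sqr_ge0// expr_le1//; last by apply: divr_ge0; lra.
  by rewrite ler_pdivrMr; lra.
rewrite ler_pdivrMr ?mul1r; last by apply: mulr_gt0; lra.
by apply: le_trans f1 _; nra.
Qed.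

Lemma jacobi_diag_bound k : 0 <= jacobi_diag k <= 2.
Proof.
rewrite /jacobi_diag.
have := mulr_ge0 (ler0n R k) kappa_ge0.
have -> : lin (2 * k%:R) = 1 + 2 * (k%:R * kappa) by ring.
have -> : lin (2 * k%:R - 1) = 1 + 2 * (k%:R * kappa) - kappa by ring.
have -> : lin (2 * k%:R + 1) = 1 + 2 * (k%:R * kappa) + kappa by ring.
have h : k = 0%N \/ kappa <= k%:R * kappa.
  by case: k => [|k]; [left|right; rewrite ler_peMl// ler1n].
move=> x0.
have f1 : 0 <= lin k%:R ^+ 2 / ((1 + 2 * (k%:R * kappa)) * (1 + 2 * (k%:R * kappa) + kappa)) <= 1.
  move: (k%:R * kappa) x0 => x x0; move: kappa kappa_ge0 => y y0.
  rewrite ler_pdivrMr ?mul1r; last by apply: mulr_gt0; lra.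
  by rewrite divr_ge0 ?sqr_ge0 ?mulr_ge0 /=; nra.
have f2 : 0 <= (k%:R * kappa) ^+ 2 / ((1 + 2 * (k%:R * kappa)) * (1 + 2 * (k%:R * kappa) - kappa)) <= 1.
  case: h => [->|]; first by rewrite mul0r expr0n mul0r lexx ler01.
  move: (k%:R * kappa) x0 => x x0; move: kappa kappa_ge0 => y y0 yx.
  rewrite ler_pdivrMr ?mul1r; last by apply: mulr_gt0; lra.
  by rewrite divr_ge0 ?sqr_ge0 ?mulr_ge0 /=; nra.
move: f1 f2; move: (_ / _) (_ / _) => a b /andP[? ?] /andP[? ?]; apply/andP; lra.
Qed.

(** The subtraction is in the field: for m < k both sides vanish. *)
Lemma jacobi_coefSr m k : jacobi_coef m k.+1 =
  jacobi_coef m k * ((m%:R - k%:R) * kappa / lin (m + k.+1)%:R).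
Proof.
rewrite /jacobi_coef ffactnSr big_ord_recr/= natrM exprSr invfM.
have [mk|km] := ltnP m k; first by rewrite ffact_small// !mul0r.
by rewrite natrB//; ring.
Qed.

Lemma jacobi_coefSS m k : jacobi_coef m.+1 k.+1 = jacobi_coef m k *
  (m.+1%:R * kappa * lin m%:R / (lin (m + k.+1)%:R * lin (m + k.+2)%:R)).
Proof.
rewrite /jacobi_coef ffactSS natrM exprSr.
have -> : \prod_(i < k.+2) lin (m.+1 + i)%:R =
    \prod_(i < k.+1) lin (m + i)%:R / lin m%:R * lin (m + k.+1)%:R * lin (m + k.+2)%:R.
  have -> : \prod_(i < k.+1) lin (m + i)%:R = \prod_(i < k) lin (m.+1 + i)%:R * lin m%:R.
    rewrite big_ord_recl addn0 mulrC; congr (_ * _).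
    by apply: eq_bigr => i _; rewrite addSnnS.
  by rewrite 2!big_ord_recr /= !addSnnS mulfK// gt_eqF ?lin_gt0.
have := lin_gt0 (ler0n R m); have := lin_gt0 (ler0n R (m + k.+1)).
have := lin_gt0 (ler0n R (m + k.+2)).
have : 0 < \prod_(i < k.+1) lin (m + i)%:R by rewrite prodr_gt0// => i _; exact: lin_gt0.
move: (\prod_(_ < _) _) (lin _) (lin _) (lin _) => P x y z P0 x0 y0 z0.
by field; rewrite ?gt_eqF.
Qed.

Lemma jacobi_coef0 m : jacobi_coef m 0 = (lin m%:R)^-1.
Proof. by rewrite /jacobi_coef big_ord1 addn0 ffactn0 expr0 !mul1r. Qed.

(** Multiplying t^m by t gives t^(m+1).  The square roots cancel, and what
remains is an identity between rational functions of m, k and kappa. *)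
Lemma jacobi_recurrence m k :
  jacobi_diag k * jacobi_vector m k + jacobi_off k * jacobi_vector m k.+1 +
  (if k is k'.+1 then jacobi_off k' * jacobi_vector m k' else 0) =
  jacobi_vector m.+1 k.
Proof.
have r0 j : jacobi_root j != 0 by rewrite gt_eqF ?jacobi_root_gt0.
have offE j : jacobi_off j * jacobi_vector m j.+1 =
    (jacobi_root j)^-1 * (jacobi_link j * jacobi_coef m j.+1).
  by rewrite /jacobi_off /jacobi_vector; field; rewrite !r0.
have offE' j : jacobi_off j * jacobi_vector m j =
    (jacobi_root j.+1)^-1 * (jacobi_link j * jacobi_coef m j).
  by rewrite /jacobi_off /jacobi_vector; field; rewrite !r0.
apply: (mulfI (r0 k)); rewrite !mulrDr offE (mulVKf (r0 _)).
rewrite (_ : jacobi_root k * jacobi_vector m.+1 k =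
  lin (2 * k%:R) * jacobi_coef m.+1 k); last first.
  by rewrite mulrA -expr2 jacobi_rootK.
rewrite (_ : jacobi_root k * (jacobi_diag k * jacobi_vector m k) =
  jacobi_diag k * lin (2 * k%:R) * jacobi_coef m k); last first.
  by rewrite -jacobi_rootK /jacobi_vector; ring.
have nz (x : R) : 0 <= x -> lin x != 0 by move=> x0; rewrite gt_eqF// lin_gt0.
case: k => [|k].
  rewrite [jacobi_root 0%N * 0]mulr0 addr0 jacobi_coefSr !jacobi_coef0 /jacobi_diag /jacobi_link.
  have := nz _ (ler0n R m); have := nz _ (ler0n R (m + 1)); have := nz _ (ler01).
  rewrite [0%:R * kappa]mul0r expr0n mul0r addr0 natrD -natr1 !mulr0 add0r mul1r => ? ? ?.
  by field; rewrite [1 + m%:R]addrC; apply/and3P.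
rewrite offE' (mulVKf (r0 _)) jacobi_coefSS.
rewrite [jacobi_coef m k.+2]jacobi_coefSr jacobi_coefSr.
rewrite /jacobi_diag /jacobi_link.
have n1 := nz _ (mulr_ge0 (ler0n R 2) (ler0n R k.+1)).
have n2 := nz _ (addr_ge0 (mulr_ge0 (ler0n R 2) (ler0n R k.+1)) ler01).
have n3 := nz _ (addr_ge0 (mulr_ge0 (ler0n R 2) (ler0n R k)) ler01).
have n4 := nz _ (ler0n R (m + k.+1)).
have n5 := nz _ (ler0n R (m + k.+2)).
move: n1 n2 n3 n4 n5.
rewrite !natrD -[k.+2%:R]natr1 -[k.+1%:R]natr1 -[m.+1%:R]natr1.
have -> : 2 * (k%:R + 1) - 1 = 2 * k%:R + 1 :> R by ring.
move: (jacobi_coef m k) k%:R m%:R => D x y n1 n2 n3 n4 n5.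
by field; do ?[apply/andP; split].
Qed.

End Jacobi.
(** * Sparse operators indexed by sites *)

Section SiteOperators.
Variable R : realType.
Local Notation l2 := (l2 R).
Local Notation l2H := (l2_hilbert R).

(** The space of the normal extension has a basis indexed by a bilateral
coordinate paired with the degree of an orthogonal polynomial, and one further
basis vector None for a possible eigenvector. *)
Definition site := option (int * nat).
Definition site_code : site -> nat := locked (fun i : site => pickle i).
Definition site_of : nat -> option site := pickle_inv.

Lemma site_codeK : pcancel site_code site_of.
Proof. by move=> i; rewrite /site_code -lock; exact: pickleK_inv. Qed.

Lemma site_ofK : ocancel site_of site_code.
Proof. by move=> n; rewrite /site_code -lock; exact: pickle_invK. Qed.

Lemma site_code_eq i j : (site_code i == site_code j) = (i == j).
Proof. exact/inj_eq/(pcan_inj site_codeK). Qed.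

Lemma site_ext (f g : l2) :
  (forall i, f (site_code i) = g (site_code i)) ->
  (forall n, site_of n = None -> f n = g n) -> f = g.
Proof.
move=> fg fg0; apply: l2_eq => n; have := site_ofK n.
by case E: (site_of n) => [i|] /=; [move=> <-; exact: fg|move=> _; exact: fg0].
Qed.

Definition site_delta i : l2H := delta (site_code i).

Lemma site_deltaE i j : (site_delta i : l2) (site_code j) = (i == j)%:R.
Proof. by rewrite deltaE site_code_eq eq_sym. Qed.

Lemma site_delta_out i n : site_of n = None ->
  (site_delta i : l2) n = 0.
Proof.
by move=> nN; rewrite deltaE; case: eqVneq => // E; rewrite E site_codeK in nN.
Qed.

(** A matrix with at most one nonzero entry in each row: the entry of row i is
a i, in column sigma i. *)
Definition site_op (a : site -> R[i]) (sigma : site -> site) : l2H -> l2H :=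
  wco (fun n => if site_of n is Some i then site_code (sigma i) else 0%N)
      (fun n => if site_of n is Some i then a i else 0).

Section OneSiteOperator.
Variables (a a' : site -> R[i]) (sigma tau : site -> site) (M : R).
Hypothesis a_bounded : forall i, sqmod (a i) <= M.
(* The second matrix is the adjoint of the first. *)
Hypothesis transpose : forall i j,
  (if sigma i == j then a i else 0) = (if tau j == i then (a' j)^* else 0).

Let bounded_coef n : sqmod (if site_of n is Some i then a i else 0) <= M.
Proof.
case: site_of => [i|]; first exact: a_bounded.
by rewrite sqmod0 (le_trans _ (a_bounded None)) ?sqmod_ge0.
Qed.

Let inj_coef n m :
  (if site_of n is Some i then a i else 0) != 0 ->
  (if site_of m is Some i then a i else 0) != 0 ->
  (if site_of n is Some i then site_code (sigma i) else 0%N) =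
  (if site_of m is Some i then site_code (sigma i) else 0%N) -> n = m.
Proof.
have := site_ofK n; have := site_ofK m.
case: (site_of m) (site_of n) => [j|] [i|] /=; rewrite ?eqxx// => <- <- ai aj /eqP.
rewrite site_code_eq => /eqP sij; congr site_code.
have tau_sigma k : a k != 0 -> tau (sigma k) = k.
  have := transpose k (sigma k); rewrite eqxx.
  by case: (tau _ =P k) => // _ ->; rewrite eqxx.
by rewrite -(tau_sigma i ai) sij tau_sigma.
Qed.

Lemma bounded_site_op : bounded_linear (site_op a sigma).
Proof. exact: (bounded_wco bounded_coef inj_coef). Qed.

Lemma site_opE (f : l2) i :
  (site_op a sigma f : l2) (site_code i) = a i * f (site_code (sigma i)).
Proof.
by rewrite wcoE ?site_codeK//; exact: (wco_everywhere bounded_coef inj_coef).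
Qed.

Lemma site_op_out (f : l2) n : site_of n = None ->
  (site_op a sigma f : l2) n = 0.
Proof.
move=> nN; rewrite wcoE ?nN ?mul0r//.
exact: (wco_everywhere bounded_coef inj_coef).
Qed.

Lemma site_op_delta j : site_op a sigma (site_delta j) =
  (a' j)^* *: site_delta (tau j).
Proof.
apply: (@site_ext (site_op _ _ _) (_ *: _)) => [i|n nN]; last first.
  by rewrite site_op_out// l2Z site_delta_out// mulr0.
rewrite site_opE l2Z !site_deltaE eq_sym.
have := transpose i j; case: (sigma i == j); case: (tau j == i);
  by rewrite ?mulr1 ?mulr0.
Qed.

Lemma site_op_delta_out n : site_of n = None ->
  site_op a sigma (delta n) = 0.
Proof.
move=> nN; apply: (@site_ext (site_op _ _ _) 0) => [i|m mN]; last by rewrite site_op_out.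
rewrite site_opE deltaE; case: eqVneq => [E|_]; last by rewrite mulr0.
by rewrite -E site_codeK in nN.
Qed.

End OneSiteOperator.

Lemma adjoint_site_op a a' sigma tau (M : R) (f g : l2H) :
  (forall i, sqmod (a i) <= M) -> (forall i, sqmod (a' i) <= M) ->
  (forall i j, (if sigma i == j then a i else 0) =
     (if tau j == i then (a' j)^* else 0)) ->
  hdot l2H (site_op a sigma f) g = hdot l2H f (site_op a' tau g).
Proof.
move=> aM aM' tr.
have tr' i j : (if tau i == j then a' i else 0) = (if sigma j == i then (a j)^* else 0).
  have := congr1 (@Num.conj _) (tr j i).
  by case: eqP => _; case: eqP => _; rewrite ?rmorph0 ?conjCK.
have [S SP] := adjoint_exists (bounded_site_op aM tr).
rewrite SP; congr (hdot _ _ _).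
apply: (@site_ext (S g) (site_op a' tau g)) => [j|n nN];
  apply: (can_inj (@conjCK _)).
  rewrite -hdot_delta -SP (site_op_delta aM tr) hdotZl hdot_delta.
  by rewrite (site_opE aM' tr') rmorphM.
rewrite -hdot_delta -SP (site_op_delta_out aM tr)//.
by rewrite linear0l (site_op_out aM' tr')// rmorph0.
Qed.

End SiteOperators.
(** * A normal operator containing weighted shifts *)

Section JacobiModel.
Variables (R : realType) (kappa : R).
Hypothesis kappa_ge0 : 0 <= kappa.
Local Notation l2 := (l2 R).
Local Notation l2H := (l2_hilbert R).

Definition diag_coef (p : R[i]) (i : site) : R[i] :=
  if i is Some (_, k) then (jacobi_diag kappa k)%:C%C else p.
Definition up_coef (i : site) : R[i] :=
  if i is Some (_, k) then (jacobi_off kappa k)%:C%C else 0.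
Definition down_coef (i : site) : R[i] :=
  if i is Some (_, k.+1) then (jacobi_off kappa k)%:C%C else 0.

Definition diag_site (d : int) (i : site) : site :=
  if i is Some (z, k) then Some (z - d, k) else None.
Definition up_site (d : int) (i : site) : site :=
  if i is Some (z, k) then Some (z - d, k.+1) else None.
Definition down_site (d : int) (i : site) : site :=
  if i is Some (z, k) then Some (z - d, k.-1) else None.

(** The tensor product of the bilateral shift by d with the Jacobi matrix, plus
the scalar p on the basis vector None. *)
Definition model (d : int) (p : R[i]) (f : l2H) : l2H :=
  site_op (diag_coef p) (diag_site d) f +
  (site_op up_coef (up_site d) f + site_op down_coef (down_site d) f).

Let diag_bound p i : sqmod (diag_coef p i) <= sqmod p + 4.
Proof.
case: i => [[z k]|] /=; last by rewrite lerDl.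
have /andP[b0 b2] := jacobi_diag_bound kappa_ge0 k.
rewrite sqmod_real ler_wpDl ?sqmod_ge0//; nra.
Qed.

Let up_bound i : sqmod (up_coef i) <= 1.
Proof.
case: i => [[z k]|] /=; last by rewrite sqmod0.
by rewrite sqmod_real; exact: jacobi_off_bound.
Qed.

Let down_bound i : sqmod (down_coef i) <= 1.
Proof.
case: i => [[z [|k]]|] /=; rewrite ?sqmod0 //.
by rewrite sqmod_real; exact: jacobi_off_bound.
Qed.

Let real_mul (x y : R) : (x * y)%:C%C = x%:C%C * y%:C%C :> R[i].
Proof. exact: rmorphM. Qed.

Let real_lin (x y z t e : R) : (x * y + z * t + e)%:C%C =
  x%:C%C * y%:C%C + (z%:C%C * t%:C%C + e%:C%C) :> R[i].
Proof. by rewrite addrA -!real_mul !rmorphD. Qed.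

Let shift_eq (z z' d : int) k k' :
  (Some (z - d, k) == Some (z', k') :> site) = (Some (z' - - d, k') == Some (z, k)).
Proof.
by apply/eqP/eqP => -[<- <-]; rewrite opprK ?subrK ?addrK.
Qed.

Let diag_tr d p i j : (if diag_site d i == j then diag_coef p i else 0) =
  (if diag_site (- d) j == i then (diag_coef p^* j)^* else 0).
Proof.
case: i j => [[z k]|] [[z' k']|] //=; last by rewrite conjCK.
by rewrite shift_eq; case: eqP => // -[_ ->]; rewrite conj_real.
Qed.

Let up_tr d i j : (if up_site d i == j then up_coef i else 0) =
  (if down_site (- d) j == i then (down_coef j)^* else 0).
Proof.
case: i j => [[z k]|] [[z' [|k']]|] //=; rewrite ?rmorph0 ?if_same//.
  by case: eqP => // -[].
by rewrite -[_ == _]/(Some (z - d, k) == Some (z', k')) shift_eq; case: eqP => // -[_ ->]; rewrite conj_real.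
Qed.

Let down_tr d i j : (if down_site d i == j then down_coef i else 0) =
  (if up_site (- d) j == i then (up_coef j)^* else 0).
Proof.
have := congr1 (@Num.conj _) (up_tr (- d) j i); rewrite opprK.
by case: eqP => _; case: eqP => _; rewrite ?rmorph0 ?conjCK.
Qed.

Lemma bounded_model d p : bounded_linear (model d p).
Proof.
apply: bounded_linearD; first exact: (bounded_site_op (diag_bound p) (diag_tr d p)).
apply: bounded_linearD; first exact: (bounded_site_op up_bound (up_tr d)).
exact: (bounded_site_op down_bound (down_tr d)).
Qed.

Definition model_row (d : int) (f : l2) (z : int) (k : nat) : R[i] :=
  (jacobi_diag kappa k)%:C%C * f (site_code (Some (z - d, k))) +
  ((jacobi_off kappa k)%:C%C * f (site_code (Some (z - d, k.+1))) +
   (if k is k'.+1 then (jacobi_off kappa k')%:C%C * f (site_code (Some (z - d, k')))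
    else 0)).

Lemma modelE d p (f : l2) z k :
  (model d p f : l2) (site_code (Some (z, k))) = model_row d f z k.
Proof.
rewrite !l2D (site_opE (diag_bound p) (diag_tr d p)).
rewrite (site_opE up_bound (up_tr d)) (site_opE down_bound (down_tr d)) /=.
by case: k => //; rewrite mul0r.
Qed.

Lemma modelE_None d p (f : l2) :
  (model d p f : l2) (site_code None) = p * f (site_code None).
Proof.
rewrite !l2D (site_opE (diag_bound p) (diag_tr d p)).
rewrite (site_opE up_bound (up_tr d)) (site_opE down_bound (down_tr d)) /=.
by rewrite !mul0r !addr0.
Qed.

Lemma model_out d p (f : l2) n : site_of n = None ->
  (model d p f : l2) n = 0.
Proof.
move=> nN; rewrite !l2D (site_op_out (diag_bound p) (diag_tr d p))//.
by rewrite (site_op_out up_bound (up_tr d))// (site_op_out down_bound (down_tr d))// !addr0.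
Qed.

Lemma adjoint_model d p f : adjoint (model d p) f = model (- d) p^* f.
Proof.
have bound' i : sqmod (diag_coef p^* i) <= sqmod p + 4.
  have -> : sqmod p = sqmod p^* by rewrite conjCE !sqmodE; case: (p) => ? ? /=; rewrite sqrrN.
  exact: diag_bound.
apply: adjointE => g; rewrite !hdotDl !hdotDr; congr (_ + _).
  exact: (adjoint_site_op _ _ (diag_bound p) bound' (diag_tr d p)).
rewrite [RHS]addrC; congr (_ + _).
  exact: (adjoint_site_op _ _ up_bound down_bound (up_tr d)).
exact: (adjoint_site_op _ _ down_bound up_bound (down_tr d)).
Qed.

(* Both compositions apply the square of the Jacobi matrix and shift the level
   by d + d'. *)
Let comm_of_coordinates (T T' : l2H -> l2H) d d' p p' :
  (forall f z k, (T f : l2) (site_code (Some (z, k))) = model_row d f z k) ->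
  (forall f z k, (T' f : l2) (site_code (Some (z, k))) = model_row d' f z k) ->
  (forall f, (T f : l2) (site_code None) = p * (f : l2) (site_code None)) ->
  (forall f, (T' f : l2) (site_code None) = p' * (f : l2) (site_code None)) ->
  (forall f n, site_of n = None -> (T f : l2) n = 0) ->
  (forall f n, site_of n = None -> (T' f : l2) n = 0) ->
  forall f, T (T' f) = T' (T f).
Proof.
move=> Tz T'z T0 T'0 Tout T'out f.
apply: (@site_ext _ (T (T' f) : l2) (T' (T f) : l2)) => [[[z k]|]|n nN].
- by case: k => [|[|k]]; rewrite Tz T'z /model_row !(Tz, T'z) /model_row ![z - d - d']addrAC; ring.
- by rewrite T0 T'0 T'0 T0 mulrCA.
- by rewrite Tout// T'out.
Qed.

Lemma model_comm d d' p p' f :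
  model d p (model d' p' f) = model d' p' (model d p f).
Proof.
apply: (@comm_of_coordinates _ _ d d' p p') => *; by [exact: modelE|exact: modelE_None|exact: model_out].
Qed.

(** The Jacobi matrix is self-adjoint and commutes with the shifts. *)
Lemma model_normal d p : normal_operator (model d p).
Proof.
split; first exact/bounded_operatorP/bounded_model.
by move=> f; rewrite !adjoint_model model_comm.
Qed.

(** The vector t^m placed at the level z of the bilateral shift. *)
Definition moment_vector (z : int) (m : nat) : l2H :=
  \sum_(k < m.+1) (jacobi_vector kappa m k)%:C%C *: site_delta R (Some (z, nat_of_ord k)).

Let l2_sum (I : Type) (r : seq I) (F : I -> l2H) n :
  ((\sum_(i <- r) F i : l2H) : l2) n = \sum_(i <- r) (F i : l2) n.
Proof.
elim: r => [|i r IH]; first by rewrite !big_nil.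
by rewrite !big_cons -IH.
Qed.

Lemma moment_vectorE z m z' k :
  (moment_vector z m : l2) (site_code (Some (z', k))) =
  if z' == z then (jacobi_vector kappa m k)%:C%C else 0.
Proof.
rewrite /moment_vector l2_sum.
under eq_bigr => j _ do rewrite l2Z site_deltaE.
have dE (j : nat) : (Some (z, j) == Some (z', k) :> site) = (z' == z) && (j == k).
  by rewrite (inj_eq Some_inj) xpair_eqE (eq_sym z).
case: (ltnP k m.+1) => km; last first.
  rewrite big1 => [|j _]; last first.
    rewrite dE [_ == k]ltn_eqF ?andbF ?mulr0//; exact: leq_trans (ltn_ord j) km.
  by rewrite /jacobi_vector /jacobi_coef ffact_small// !mul0r mulr0 if_same.
rewrite (bigD1 (Ordinal km))//= dE eqxx andbT big1 => [|j jk]; last first.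
  by rewrite dE [_ == k](negbTE _) ?andbF ?mulr0//.
by rewrite addr0; case: eqP; rewrite ?mulr1 ?mulr0.
Qed.

Lemma moment_vectorE_None z m : (moment_vector z m : l2) (site_code None) = 0.
Proof.
by rewrite /moment_vector l2_sum big1// => j _; rewrite l2Z site_deltaE mulr0.
Qed.

Lemma moment_vector_out z m n : site_of n = None ->
  (moment_vector z m : l2) n = 0.
Proof.
by move=> nN; rewrite /moment_vector l2_sum big1// => j _; rewrite l2Z site_delta_out ?mulr0.
Qed.

(** The model multiplies by t and raises the level. *)
Lemma model_moment_vector d p z m :
  model d p (moment_vector z m) = moment_vector (z + d) m.+1.
Proof.
apply: (@site_ext _ (model _ _ _ : l2) (moment_vector _ _ : l2)) => [[[z' k]|]|n nN].
- have row j : (moment_vector z m : l2) (site_code (Some (z' - d, j))) =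
      if z' == z + d then (jacobi_vector kappa m j)%:C%C else 0.
    by rewrite moment_vectorE subr_eq.
  rewrite modelE moment_vectorE /model_row !row -jacobi_recurrence//.
  case: eqP => zz'; last first.
    by case: k => [|k]; rewrite ?row ?(introF eqP zz') !mulr0 !addr0.
  rewrite real_lin; congr (_ + (_ + _)); case: k => // k.
  by rewrite row (introT eqP zz') [RHS]real_mul.
- by rewrite modelE_None !moment_vectorE_None mulr0.
- by rewrite model_out// moment_vector_out.
Qed.

Lemma hdot_moment_vector_eq0 (f : l2) z m :
  (forall k, f (site_code (Some (z, k))) = 0) -> hdot l2H f (moment_vector z m) = 0.
Proof.
move=> f0; rewrite hdotC hdot_suml big1 ?rmorph0// => k _.
by rewrite hdotZl hdot_delta f0 rmorph0 mulr0.
Qed.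

Lemma moment_vector_orthogonal z z' m m' : z != z' ->
  hdot l2H (moment_vector z m) (moment_vector z' m') = 0.
Proof.
move=> zz'; apply: hdot_moment_vector_eq0 => k.
by rewrite moment_vectorE eq_sym (negbTE zz').
Qed.

(** Self-adjointness moves the factors t from one side to the other until the
left vector is the constant 1. *)
Lemma hdot_moment_vector z m m' :
  hdot l2H (moment_vector z m) (moment_vector z m') =
  ((1 + (m + m')%:R * kappa)^-1)%:C%C.
Proof.
elim: m z m' => [|m IH] z m'.
  rewrite /moment_vector big_ord1 hdotZl hdot_delta moment_vectorE eqxx conj_real.
  rewrite -rmorphM /jacobi_vector /jacobi_root !jacobi_coef0 mulr0 !mul0r !addr0.
  by rewrite sqrtr1 !mul1r invr1 mul1r.
have -> : moment_vector z m.+1 = model 1 0 (moment_vector (z - 1) m).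
  by rewrite model_moment_vector subrK.
rewrite hdot_adjoint; last exact: bounded_model.
by rewrite adjoint_model model_moment_vector IH addSnnS.
Qed.

End JacobiModel.
(** * Construction of normal extensions *)

Section SubnormalExtensions.
Variable R : realType.
Local Notation l2 := (l2 R).
Local Notation l2H := (l2_hilbert R).
Implicit Types (K : hilbert R).

(** A normal operator acting on an orthonormal sequence as S acts on the
standard basis extends S. *)
Lemma subnormal_of_orthonormal K (N : K -> K) (u : nat -> K) (S : l2H -> l2H) :
  bounded_linear S -> normal_operator N ->
  (forall n m, hdot K (u n) (u m) = (n == m)%:R) ->
  (forall V : l2H -> K, linear V -> (forall n, V (delta n) = u n) ->
    forall n, N (u n) = V (S (delta n))) ->
  subnormal S.
Proof.
move=> bS nN ou Nu; have [V [bV iV Vu]] := orthonormal_isometry ou.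
exists K, V, N; split=> //; first exact: bV.1.
have bN : bounded_linear N by apply/bounded_operatorP; case: nN.
apply: (bounded_l2_ext (bounded_linear_comp bN bV) (bounded_linear_comp bV bS)).
by move=> n /=; rewrite Vu (Nu V bV.1 Vu).
Qed.

Section ShiftVectors.
Variables (kappa : R) (z0 : int) (p : R[i]) (v : nat -> R[i]).
Hypothesis kappa_ge0 : 0 <= kappa.
Hypothesis v_prod : forall n, \prod_(i < n) sqmod (v i) = (1 + n%:R * (2 * kappa))^-1.

(** Dividing by the product of the weights turns the model, which acts on the
moment vectors as an unweighted shift, into the shift with weights v. *)
Definition shift_vector n : l2H :=
  (\prod_(i < n) v i)^-1 *: moment_vector kappa (z0 + n%:Z) n.

Let prod_neq0 n : \prod_(i < n) v i != 0.
Proof.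
apply/eqP => /(congr1 (@sqmod R)) /eqP; rewrite sqmod_prod v_prod sqmod0.
by rewrite invr_eq0 gt_eqF// ltr_wpDr// !mulr_ge0.
Qed.

Lemma model_shift_vector n :
  model kappa 1 p (shift_vector n) = v n *: shift_vector n.+1.
Proof.
have [lN _] := bounded_model kappa_ge0 1 p.
rewrite (linear_mapZ _ _ lN) model_moment_vector// scalerA big_ord_recr/=.
rewrite -addrA intS [1 + n%:Z]addrC; congr (_ *: _).
have := prod_neq0 n.+1; rewrite big_ord_recr/= mulf_eq0 negb_or => /andP[P0 vn0].
by rewrite invfM mulrCA divff// mulr1.
Qed.

Lemma shift_vector_orthonormal n m :
  hdot l2H (shift_vector n) (shift_vector m) = (n == m)%:R.
Proof.
rewrite hdotZl hdotZr; have [->|nm] := eqVneq n m; last first.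
  rewrite moment_vector_orthogonal ?mulr0//.
  by apply: contra nm => /eqP/addrI/eqP; rewrite eqz_nat.
rewrite hdot_moment_vector// mulrA -normCK -sqmodC -rmorphM sqmodV sqmod_prod v_prod.
have -> : (m + m)%:R * kappa = m%:R * (2 * kappa) by rewrite natrD; ring.
by rewrite invrK divff// gt_eqF// ltr_wpDr// !mulr_ge0.
Qed.

End ShiftVectors.

(** The moments 1 / (1 + n e) are those of t^2 for the Jacobi matrix with
parameter e / 2. *)
Lemma weighted_shift_subnormal (S : l2H -> l2H) (v : nat -> R[i]) (e : R) :
  bounded_linear S -> 0 <= e -> (forall n, S (delta n) = v n *: delta n.+1) ->
  (forall n, \prod_(i < n) sqmod (v i) = (1 + n%:R * e)^-1) -> subnormal S.
Proof.
move=> bS e0 Sv vE.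
have k0 : 0 <= e / 2 by rewrite divr_ge0.
have v_prod n : \prod_(i < n) sqmod (v i) = (1 + n%:R * (2 * (e / 2)))^-1.
  by rewrite [2 * _]mulrC divfK// vE.
apply: (subnormal_of_orthonormal bS (model_normal k0 1 0) (shift_vector_orthonormal 0 k0 v_prod)).
by move=> V lV VE n; rewrite (model_shift_vector _ _ k0 v_prod) Sv (linear_mapZ _ _ lV) VE.
Qed.

Section PerturbedShiftExtension.
Variables (S : l2H -> l2H) (p q : R[i]) (v : nat -> R[i]) (c : R).
Hypothesis bS : bounded_linear S.
Hypothesis c_ge0 : 0 <= c.
Hypothesis S_delta0 : S (delta 0) = p *: delta 0 + q *: delta 1.
Hypothesis S_deltaS : forall n, S (delta n.+1) = v n *: delta n.+2.
Hypothesis v_prod : forall n, \prod_(i < n) sqmod (v i) = (1 + n%:R * c)^-1.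

(** The vectors beyond the first are prescribed by the weighted shift; only the
image u0 of delta 0 has to be found. *)
Lemma perturbed_shift_subnormal (u0 : l2H) :
  model (c / 2) 1 p u0 = p *: u0 + q *: moment_vector (c / 2) 1 0 ->
  hsqnorm u0 = 1 ->
  (forall n, hdot l2H u0 (moment_vector (c / 2) (1 + n%:Z) n) = 0) ->
  subnormal S.
Proof.
move=> Nw0 u01 u0_orth.
have k0 : 0 <= c / 2 by rewrite divr_ge0.
have v_prod' n : \prod_(i < n) sqmod (v i) = (1 + n%:R * (2 * (c / 2)))^-1.
  by rewrite [2 * _]mulrC divfK// v_prod.
pose u n := if n is n'.+1 then shift_vector (c / 2) 1 v n' else u0.
apply: (@subnormal_of_orthonormal _ _ u _ bS (model_normal k0 1 p)) => [n m|V lV VE n].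
  have orth k : hdot l2H u0 (shift_vector (c / 2) 1 v k) = 0.
    by rewrite hdotZr u0_orth mulr0.
  case: n m => [|n] [|m]; rewrite {}/u; first by rewrite hsqnormE u01.
  - exact: orth.
  - by rewrite hdotC orth rmorph0.
  - by rewrite eqSS; exact: shift_vector_orthonormal.
case: n => [|n] /=.
  rewrite S_delta0 (linear_mapD _ _ lV) !(linear_mapZ _ _ lV) !VE Nw0.
  by rewrite /u /shift_vector big_ord0 invr1 scale1r addr0.
by rewrite S_deltaS (linear_mapZ _ _ lV) VE (model_shift_vector _ _ k0 v_prod').
Qed.

(** For q = 0 the vector delta 0 is an eigenvector, modelled by the last site. *)
Lemma reducing_shift_subnormal : q = 0 -> subnormal S.
Proof.
move=> q0; have k0 : 0 <= c / 2 by rewrite divr_ge0.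
apply: (@perturbed_shift_subnormal (site_delta R None)).
- rewrite q0 scale0r addr0.
  apply: (@site_ext _ (model _ _ _ _ : l2) (_ : l2H)) => [[[z k]|]|n nN].
  + by rewrite modelE// /model_row l2Z !site_deltaE; case: k => [|k]; rewrite ?site_deltaE !mulr0 !addr0.
  + by rewrite modelE_None// l2Z.
  + by rewrite model_out// l2Z site_delta_out// mulr0.
- by rewrite /hsqnorm hdot_deltas eqxx.
- by move=> n; apply: hdot_moment_vector_eq0 => k; rewrite site_deltaE.
Qed.

Section IsometricShift.
(* With c = 0 the model is the bilateral shift U plus the scalar p.  The
   equation for u0 has the solution q (U - p)^-1 e, with e the basis vector of
   level 1, whose coordinates at the levels 0, -1, -2, ... are q, q p, q p^2,
   ...; its squared norm is at most 1, and the last site supplies the rest. *)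
Hypothesis c0 : c = 0.
Hypothesis p_lt1 : sqmod p < 1.
Hypothesis q_le : sqmod q <= 1 - sqmod p.

Let powers_subproof : (fun n : nat => p ^+ n) \in @l2_pred R.
Proof.
apply/l2_predE; apply: le_lt_trans (ltry ((1 - sqmod p)^-1)).
apply: square_integrable_sums => N.
have -> : \sum_(0 <= k < N) sqmod (p ^+ k) = \sum_(0 <= k < N) sqmod p ^+ k.
  by apply: eq_bigr => k _; exact: sqmodX.
have s1 : 0 < 1 - sqmod p by rewrite subr_gt0.
rewrite -[leRHS]mul1r ler_pdivlMr// mulrC big_mkord -[1 - _]opprB mulNr -subrX1 opprB.
by rewrite gerDl oppr_le0 exprn_ge0// sqmod_ge0.
Qed.

(* The index of the powers of p at the sites of nonpositive level. *)
Let half_line (n : nat) : option nat :=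
  if site_of n is Some (Some (z, 0%N)) then if (z : int) <= 0 then Some `|z|%N else None
  else None.

Let half_line_inj n m k : half_line n = Some k -> half_line m = Some k -> n = m.
Proof.
rewrite /half_line.
have := site_ofK n; have := site_ofK m.
case: (site_of n) => [[[z [|?]]|]|]//= + <-.
case: (site_of m) => [[[z' [|?]]|]|]//= <-.
case: ifP => // z_le0 [<-]; case: ifP => // z'_le0 [zz'].
suff -> : z = z' by [].
by lia.
Qed.

Let tail_index n : nat := odflt 0%N (half_line n).
Let tail_coef n : R[i] := (half_line n != None)%:R.

Let tail_bound n : sqmod (tail_coef n) <= 1.
Proof.
by rewrite /tail_coef; case: (_ != _); rewrite ?sqmod0 ?sqmod1.
Qed.

Let tail_inj n m : tail_coef n != 0 -> tail_coef m != 0 ->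
  tail_index n = tail_index m -> n = m.
Proof.
rewrite /tail_coef /tail_index.
case En: (half_line n) => [k|]; last by rewrite eqxx.
case Em: (half_line m) => [l|]; last by rewrite eqxx.
by move=> _ _ /= kl; apply: (half_line_inj En); rewrite Em kl.
Qed.

Let tail : l2H := wco tail_index tail_coef (L2 powers_subproof : l2H).

Let tail_coord n : (tail : l2) n = tail_coef n * p ^+ tail_index n.
Proof. by rewrite wcoE//; exact: (wco_everywhere tail_bound tail_inj). Qed.

Let tailE z k : (tail : l2) (site_code (Some (z, k))) =
  if (k == 0%N) && (z <= 0) then p ^+ `|z|%N else 0.
Proof.
rewrite tail_coord /tail_coef /tail_index /half_line site_codeK.
by case: k => [|k] /=; rewrite ?mul0r//; case: ifP => _; rewrite ?mul1r ?mul0r.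
Qed.

Let tailE_None : (tail : l2) (site_code None) = 0.
Proof.
by rewrite tail_coord /tail_coef /tail_index /half_line site_codeK mul0r.
Qed.

Let tail_out n : site_of n = None -> (tail : l2) n = 0.
Proof. by move=> nN; rewrite tail_coord /tail_coef /half_line nN mul0r. Qed.

Let kE : c / 2 = 0. Proof. by rewrite c0 mul0r. Qed.

Let diag0 k : jacobi_diag (0 : R) k = 1.
Proof. by rewrite /jacobi_diag !mulr0 addr0 !expr1n expr0n mul0r addr0 mulr1 invr1 mulr1. Qed.

Let off0 k : jacobi_off (0 : R) k = 0.
Proof. by rewrite /jacobi_off /jacobi_link mulr0 !mul0r. Qed.

Let vector0 k : jacobi_vector (0 : R) 0 k = (k == 0%N)%:R.
Proof.
case: k => [|k]; last by rewrite /jacobi_vector /jacobi_coef ffact_small// !mul0r mulr0.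
by rewrite /jacobi_vector jacobi_coef0 /jacobi_root !mulr0 addr0 sqrtr1 invr1 mulr1.
Qed.

Let model0E d r (f : l2) z k : (model 0 d r f : l2) (site_code (Some (z, k))) =
  f (site_code (Some (z - d, k))).
Proof.
by rewrite modelE// /model_row diag0 off0; case: k => [|k]; rewrite ?off0 mul1r !mul0r !addr0.
Qed.

Let model_tail : model 0 1 p tail = p *: tail + moment_vector 0 1 0.
Proof.
apply: (@site_ext _ (model _ _ _ _ : l2) (_ : l2H)) => [[[z k]|]|n nN].
- rewrite model0E l2D l2Z !tailE moment_vectorE vector0.
  case: k => [|k] /=; last by rewrite mulr0 add0r if_same.
  have [z_le0|z_gt0] := leP z 0.
    rewrite (_ : z - 1 <= 0); last by lia.
    rewrite (_ : z == 1 = false); last by apply/eqP; lia.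
    by rewrite addr0 -exprS; congr (_ ^+ _); lia.
  rewrite mulr0 add0r; have [->|z1] := eqVneq z 1; first by rewrite subrr lexx expr0.
  by rewrite (_ : z - 1 <= 0 = false)//; lia.
- by rewrite modelE_None// l2D l2Z tailE_None moment_vectorE_None !mulr0 addr0.
- by rewrite model_out// l2D l2Z tail_out// moment_vector_out// mulr0 addr0.
Qed.

Let tail_orth n m : hdot l2H tail (moment_vector 0 (1 + n%:Z) m) = 0.
Proof.
apply: hdot_moment_vector_eq0 => k; rewrite tailE.
by rewrite (_ : 1 + n%:Z <= 0 = false) ?andbF//; lia.
Qed.

(* The bilateral shift preserves the norm, and tail is orthogonal to the vector
   of level 1; so the squared norm x satisfies x = |p|^2 x + 1. *)
Let hsqnorm_tail : hsqnorm tail = (1 - sqmod p)^-1.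
Proof.
have : hsqnorm (model 0 1 p tail) = hsqnorm tail.
  rewrite /hsqnorm hdot_adjoint; last exact: bounded_model.
  rewrite adjoint_model//; congr (complex.Re (hdot _ _ _)).
  apply: (@site_ext _ (model _ _ _ _ : l2) (_ : l2)) => [[[z k]|]|n nN].
  - by rewrite !model0E opprK addrK.
  - by rewrite !modelE_None// tailE_None !mulr0.
  - by rewrite model_out// tail_out.
rewrite model_tail hsqnormD hsqnormZ hdotZl (tail_orth 0 0) mulr0 /= mulr0 addr0.
have -> : hsqnorm (moment_vector (0 : R) 1 0) = 1.
  by rewrite /hsqnorm hdot_moment_vector// mulr0 addr0 invr1.
move: (hsqnorm tail) => x E; apply: (mulfI (_ : 1 - sqmod p != 0)).
  by rewrite subr_eq0 gt_eqF.
rewrite divff ?subr_eq0 ?gt_eqF//; lra.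
Qed.

Lemma isometric_shift_subnormal : subnormal S.
Proof.
pose mu := 1 - sqmod q / (1 - sqmod p).
have mu0 : 0 <= mu by rewrite subr_ge0 ler_pdivrMr ?mul1r// subr_gt0.
apply: (@perturbed_shift_subnormal
  (q *: tail + (Num.sqrt mu)%:C%C *: site_delta R None)); rewrite ?kE.
- have [lN _] := bounded_model (lexx 0) 1 p.
  rewrite (linear_mapD _ _ lN) !(linear_mapZ _ _ lN) model_tail.
  have -> : model 0 1 p (site_delta R None) = p *: site_delta R None.
    apply: (@site_ext _ (model _ _ _ _ : l2) (_ : l2H)) => [[[z k]|]|n nN].
    - by rewrite model0E l2Z !site_deltaE mulr0.
    - by rewrite modelE_None// l2Z.
    - by rewrite model_out// l2Z site_delta_out// mulr0.
  by rewrite !scalerDr !scalerA [q * p]mulrC [_%:C%C * p]mulrC addrAC.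
- rewrite hsqnormD !hsqnormZ hdotZl hdotZr hdot_deltar tailE_None !mulr0 addr0 hsqnorm_tail.
  have -> : hsqnorm (site_delta R None) = 1 by rewrite /hsqnorm hdot_deltas eqxx.
  have -> : sqmod ((Num.sqrt mu)%:C%C : R[i]) = mu.
    by rewrite sqmod_real sqr_sqrtr.
  by rewrite /mu; ring.
- move=> n; rewrite hdotDl !hdotZl tail_orth hdot_moment_vector_eq0 ?mulr0 ?addr0//.
  by move=> k; rewrite site_deltaE.
Qed.

End IsometricShift.
End PerturbedShiftExtension.
End SubnormalExtensions.
(** * Hausdorff moment sequences *)

Section HausdorffMoments.
Variable R : realType.
Local Notation I := (`[0%R, 1%R]%classic : set (measurableTypeR R)).
Local Notation hausdorff := (@hausdorff_moment R).
Implicit Types (g : nat -> R) (nu : {measure set (measurableTypeR R) -> \bar R}).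

(** The moments of the measure with density f with respect to nu on the unit
interval. *)
Definition density_moment nu g : Prop := exists f : R -> R,
  (forall t, I t -> 0 <= f t) /\
  forall n, nu.-integrable I (EFin \o (fun t : R => t ^+ n * f t)) /\
    g n = \int[nu]_(t in I) (t ^+ n * f t).

Lemma density_moment_ge0 nu g : density_moment nu g -> 0 <= g 0.
Proof.
move=> [f [f0 /(_ 0%N)[_ ->]]]; apply: Rintegral_ge0 => t It.
by rewrite expr0 mul1r f0.
Qed.

Lemma density_moment_descent nu g : density_moment nu g -> density_moment nu (descent g).
Proof.
move=> [f [f0 fg]]; exists (fun t => (1 - t) * f t); split.
  by move=> t It; rewrite mulr_ge0 ?f0//; move: It; rewrite /= in_itv/= subr_ge0 => /andP[].
move=> n; have [i1 g1] := fg n; have [i2 g2] := fg n.+1.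
have E : (fun t : R => t ^+ n * ((1 - t) * f t)) =
    (fun t => t ^+ n * f t - t ^+ n.+1 * f t).
  by apply/funext => t; rewrite exprS; ring.
rewrite E; split; last by rewrite /descent g1 g2 RintegralB.
have := integrableB _ i1 i2; exact.
Qed.

Lemma density_moment_shift_sub nu (s : R) g :
  density_moment nu g -> density_moment nu (shift_sub s (shift_sub s g)).
Proof.
move=> [f [f0 fg]]; exists (fun t => (t - s) ^+ 2 * f t); split.
  by move=> t It; rewrite mulr_ge0 ?f0 ?sqr_ge0.
move=> n; have [i0 g0] := fg n; have [i1 g1] := fg n.+1; have [i2 g2] := fg n.+2.
have E : (fun t : R => t ^+ n * ((t - s) ^+ 2 * f t)) =
    (fun t => t ^+ n.+2 * f t - ((2 * s) * (t ^+ n.+1 * f t) - s ^+ 2 * (t ^+ n * f t))).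
  by apply/funext => t; rewrite !exprS; ring.
have j1 : nu.-integrable I (EFin \o (fun t : R => (2 * s) * (t ^+ n.+1 * f t))).
  have := integrableZl _ (2 * s) i1; exact.
have j0 : nu.-integrable I (EFin \o (fun t : R => s ^+ 2 * (t ^+ n * f t))).
  have := integrableZl _ (s ^+ 2) i0; exact.
have j : nu.-integrable I (EFin \o (fun t : R =>
    (2 * s) * (t ^+ n.+1 * f t) - s ^+ 2 * (t ^+ n * f t))).
  have := integrableB _ j1 j0; exact.
rewrite E; split; first by have := integrableB _ i2 j; exact.
rewrite !RintegralB// !RintegralZl// -g0 -g1 -g2 /shift_sub; ring.
Qed.

Let measurable_pow n :
  measurable_fun (`[0%R, 1%R] : set R) (fun t : R => (t ^+ n)%:E).
Proof. by apply/measurable_EFinP/measurable_funTS; exact: exprn_measurable. Qed.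

Lemma hausdorff_density_moment g : hausdorff g -> exists nu, density_moment nu g.
Proof.
move=> [nu nug]; exists nu, (fun=> 1); split=> // n.
have -> : (fun t : R => t ^+ n * 1) = (fun t => t ^+ n).
  by apply/funext => t; rewrite mulr1.
split; last by rewrite /Rintegral -nug.
apply/integrableP; split; first exact: measurable_pow.
apply: (@le_lt_trans _ _ (\int[nu]_(t in I) (t ^+ n)%:E)%E).
  rewrite le_eqVlt; apply/orP; left; apply/eqP; apply: eq_integral => t.
  by rewrite inE /= in_itv/= => /andP[t0 _]; rewrite ger0_norm ?exprn_ge0.
by rewrite -nug ltry.
Qed.

(** The polynomial (t - s)^2 (1 - t)^(2m) is nonnegative. *)
Lemma defect_moment_not_hausdorff (s Q c : R) : 0 < s -> 0 < Q -> 0 < c ->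
  ~ hausdorff (defect_moment s Q c).
Proof.
move=> s0 Q0 c0 /hausdorff_density_moment[nu]/(density_moment_shift_sub s) mom.
have [m neg] := defect_moment_not_positive s0 Q0 c0.
suff /density_moment_ge0 : density_moment nu (iter m.*2 (@descent R)
    (shift_sub s (shift_sub s (defect_moment s Q c)))) by rewrite leNgt neg.
by elim: m.*2 => //= k; exact: density_moment_descent.
Qed.

Lemma hausdorff_ext g g' : (forall n, g n = g' n) ->
  hausdorff g -> hausdorff g'.
Proof. by move=> gg'; rewrite (funext gg'). Qed.

Lemma hausdorff_powers (s : R) : 0 <= s <= 1 -> hausdorff (fun n => s ^+ n).
Proof.
move=> s01; exists (@dirac _ (measurableTypeR R) s R) => n.
rewrite integral_dirac//; last exact: measurable_pow.
by rewrite /dirac indicE mem_set ?mul1e//= in_itv.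
Qed.

Lemma hausdorff_add g g' : hausdorff g -> hausdorff g' ->
  hausdorff (fun n => g n + g' n).
Proof.
move=> [nu nug] [nu' nug']; exists (measure_add nu nu') => n.
rewrite ge0_integral_measure_add//; try exact: measurable_pow; first by rewrite -nug -nug'.
by move=> t; rewrite /= in_itv/= => /andP[t0 _]; rewrite lee_fin exprn_ge0.
Qed.

Lemma hausdorff_scale (a : R) g : 0 <= a -> hausdorff g ->
  hausdorff (fun n => a * g n).
Proof.
move=> a0 [nu nug]; exists (mscale (NngNum a0) nu) => n.
rewrite ge0_integral_mscale//; try exact: measurable_pow; first by rewrite -nug.
by move=> t; rewrite /= in_itv/= => /andP[t0 _]; rewrite lee_fin exprn_ge0.
Qed.

Lemma powR_derivable_LR (a : R) : 0 < a -> derivable_oo_LRcontinuous (@powR R ^~ a) 0 1.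
Proof.
move=> a0; split.
- move=> x; rewrite in_itv/= => /andP[x0 _].
  by apply: derivable_powR; rewrite in_itv/= x0.
- by rewrite powR0 ?gt_eqF//; exact: powR_cvg0.
- apply: cvg_at_left_filter.
  have /derivable1_diffP/differentiable_continuous : derivable (@powR R ^~ a) 1 1.
    by apply: derivable_powR; rewrite in_itv/= ltr01.
  exact.
Qed.

Lemma integral_powR01 (a : R) : 0 < a ->
  (\int[lebesgue_measure]_(x in I) (x `^ a)%:E = ((1 + a)^-1)%:E)%E.
Proof.
move=> a0; have a1 : 0 < 1 + a by rewrite addr_gt0.
have FTC : (\int[lebesgue_measure]_(x in I) ((1 + a) * x `^ a)%:E = 1)%E.
  rewrite (@continuous_FTC2 _ _ (@powR R ^~ (1 + a)))//.
  - by rewrite powR1 powR0 ?gt_eqF// sube0.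
  - move=> x; apply: (@continuous_comp (subspace _) R R (@powR R ^~ a) ( *%R (1 + a))).
      exact: (derivable_oo_LRcontinuous_within (powR_derivable_LR a0)).
    exact: mulrl_continuous.
  - exact: powR_derivable_LR.
  - move=> x; rewrite in_itv/= => /andP[x0 _].
    rewrite powR_derive1 ?in_itv/= ?x0//; congr (_ * _ `^ _); ring.
have -> : (fun x : R => (x `^ a)%:E) = (fun x => ((1 + a)^-1)%:E * ((1 + a) * x `^ a)%:E)%E.
  by apply/funext => x; rewrite -EFinM mulKf// gt_eqF.
rewrite ge0_integralZl_EFin ?FTC ?mule1 ?invr_ge0 ?ltW//.
- by move=> x _; rewrite lee_fin mulr_ge0 ?powR_ge0// ltW.
- apply/measurable_EFinP/measurable_funM => //; apply: measurable_funTS; exact: measurable_powR.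
Qed.

(** For U uniform on the unit interval, U^kappa has moments
1 / (1 + n kappa). *)
Lemma hausdorff_harmonic (kappa : R) : 0 <= kappa ->
  hausdorff (fun n => (1 + n%:R * kappa)^-1).
Proof.
rewrite le_eqVlt => /predU1P[<-|k0].
  apply: (@hausdorff_ext (fun n => 1 ^+ n)) => [n|].
    by rewrite mulr0 addr0 invr1 expr1n.
  by apply: hausdorff_powers; rewrite ler01 lexx.
pose T : measurableType _ := measurableTypeR R.
have mk : @measurable_fun _ _ T T setT (@powR R ^~ kappa) by exact: measurable_powR.
pose phi : T -> T := @powR R ^~ kappa.
exists (pushforward (uniform_prob (@ltr01 R)) phi) => n.
rewrite ge0_integral_pushforward//; last 2 first.
- exact: measurable_pow.
- by move=> t; rewrite inE /= in_itv/= => /andP[t0 _]; rewrite lee_fin exprn_ge0.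
have mpre : measurable (phi @^-1` I) by rewrite -[_ @^-1` _]setTI; exact: (mk measurableT _ (measurable_itv _)).
rewrite integral_mkcond integral_uniform; last 2 first.
- apply/(measurable_restrictT _ mpre).
  apply/measurable_funTS/measurable_EFinP.
  exact: (measurableT_comp (exprn_measurable n) (measurable_powR kappa)).
- move=> x; rewrite patchE; case: ifP => // _.
  by rewrite lee_fin exprn_ge0// powR_ge0.
rewrite subr0 invr1 mul1e.
transitivity (\int[lebesgue_measure]_(x in I) (x `^ (n%:R * kappa))%:E)%E; last first.
  apply: eq_integral => x; rewrite inE /= in_itv/= => /andP[x0 x1].
  rewrite patchE mem_set /=; first by rewrite -powR_mulrn ?powR_ge0// -powRrM mulrC.
  have one : 1 `^ kappa = 1 :> R by rewrite powR1.
  by rewrite in_itv/= powR_ge0/= -one ge0_ler_powR// ?nnegrE// ltW.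
case: n => [|n]; last by rewrite integral_powR01// mulr_gt0.
under eq_integral do rewrite mul0r powRr0.
rewrite integral_cst//= mul0r addr0 invr1 mul1e.
by rewrite lebesgue_measure_itv/= lte_fin ltr01 oppr0 adde0.
Unshelve. exact: (mk). Qed.

End HausdorffMoments.
(** * The characterization of subnormality *)

Section HausdorffDefect.
Variable R : realType.
Local Notation hausdorff := (@hausdorff_moment R).

(** For c = 0 the recurrence is affine, and its solution mixes unit masses at 1
and at s. *)
Lemma hausdorff_defect_isometric (s Q : R) : 0 <= s < 1 -> 0 <= Q <= 1 - s ->
  hausdorff (defect_moment s Q 0).
Proof.
move=> /andP[s0 s1] /andP[Q0 Qs]; have s1' : 0 < 1 - s by rewrite subr_gt0.
pose a := Q / (1 - s).
have a0 : 0 <= a by rewrite divr_ge0// ltW.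
have a1 : 0 <= 1 - a by rewrite subr_ge0 ler_pdivrMr ?mul1r.
apply: (@hausdorff_ext _ (fun n => a * 1 ^+ n + (1 - a) * s ^+ n)) => [n|].
  elim: n => [|n IH]; first by rewrite defect_moment0 !expr0; ring.
  rewrite defect_momentS -IH !expr1n mulr0 addr0 divr1 exprS.
  have -> : Q = a * (1 - s) by rewrite divfK// gt_eqF.
  ring.
apply: hausdorff_add; apply: hausdorff_scale => //; apply: hausdorff_powers.
  by rewrite ler01 lexx.
by rewrite s0 ltW.
Qed.

Lemma hausdorff_defect_reducing (c : R) : hausdorff (defect_moment 1 0 c).
Proof.
apply: (@hausdorff_ext _ (fun n => 1 ^+ n)) => [n|].
  elim: n => [|n IH]; first by rewrite defect_moment0.
  by rewrite defect_momentS -IH !expr1n mul0r addr0 mulr1.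
by apply: hausdorff_powers; rewrite ler01 lexx.
Qed.

Lemma hausdorff_defect_shift (Q c e : R) : 0 <= e ->
  (forall n, Q / (1 + n%:R * c) = (1 + n.+1%:R * e)^-1) ->
  hausdorff (defect_moment 0 Q c).
Proof.
move=> e0 QE; apply: hausdorff_ext (hausdorff_harmonic e0) => -[|n].
  by rewrite defect_moment0 mul0r addr0 invr1.
by rewrite defect_momentS mul0r add0r QE.
Qed.

End HausdorffDefect.

Theorem theorem3p3 (R : realType) (phi : nat -> nat) (w : nat -> R[i])
  (phi0 : phi 0%N = 0%N) (phiS : forall n : nat, phi n.+1 = n)
  (C_everywhere : wco_domain phi w = setT)
  (C_two_isometry : two_isometry (wco phi w)) :
  let h := fun n : nat =>
    RN_derivative (iter n phi) (weight_prod phi (dual_weight phi w) n) 0%N in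
  (subnormal (cauchy_dual (wco phi w)) <->
   hausdorff_moment (fun n : nat => fine (h n))) /\
  (forall n : nat,
    h n = (Normc.normc (w 0%N) ^+ (2 * n) / alpha w ^+ (2 * n) +
      \sum_(j < n)
        Normc.normc (w 0%N) ^+ (2 * (n - j - 1)) * Normc.normc (w 1%N) ^+ 2 /
        (alpha w ^+ (2 * (n - j)) *
         (1 + j%:R * (Normc.normc (w 2%N) ^+ 2 - 1))))%:E).
Proof.
move=> h; set a0 := sqmod (w 0%N); set a1 := sqmod (w 1%N).
set al := alpha w; set c := sqmod (w 2%N) - 1.
have hE n : h n = (defect_moment (a0 / al ^+ 2) (a1 / al ^+ 2) c n)%:E.
  exact: (RN_derivative_iterate phi0 phiS C_everywhere C_two_isometry).
split; last first.
  by move=> n; rewrite hE (defect_moment_closed_form phi0 phiS C_everywhere C_two_isometry).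
rewrite (_ : (fun n => fine (h n)) = defect_moment (a0 / al ^+ 2) (a1 / al ^+ 2) c); last first.
  by apply/funext => n; rewrite hE.
have bS := bounded_cauchy_dual phi0 phiS C_everywhere C_two_isometry.
have S0 := cauchy_dual_delta0 phi0 phiS C_everywhere C_two_isometry.
have SS := cauchy_dual_deltaS phi0 phiS C_everywhere C_two_isometry.
have v_prod := dual_shift_prod phi0 phiS C_everywhere C_two_isometry.
have rel : a1 * c = (1 - a0) * (al - 1) := weight_relation phi0 phiS C_everywhere C_two_isometry.
have c0 : 0 <= c := weight_c_ge0 phi0 phiS C_everywhere C_two_isometry.
have al1 : 1 <= al := alpha_ge1 phi0 phiS C_everywhere C_two_isometry.
have alE : al = a0 + a1 by [].
have a0_ge0 : 0 <= a0 := sqmod_ge0 _.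
have a1_ge0 : 0 <= a1 := sqmod_ge0 _.
have al0 : 0 < al by exact: lt_le_trans al1.
have alz : al%:C%C != 0 :> R[i] by rewrite fmorph_eq0 gt_eqF.
have sqmod_p : sqmod (w 0%N / al%:C%C) = a0 / al ^+ 2 by rewrite sqmod_divr.
have sqmod_q : sqmod (w 1%N / al%:C%C) = a1 / al ^+ 2 by rewrite sqmod_divr.
have [a1z|a1nz] := eqVneq a1 0.
  have a01 : a0 = 1.
    move: rel; rewrite alE a1z mul0r addr0 => /esym/eqP.
    by rewrite mulf_eq0 => /orP[/eqP|/eqP] ?; lra.
  have q0 : w 1%N / al%:C%C = 0.
    by move/eqP: a1z; rewrite sqmod_eq0 => /eqP ->; rewrite mul0r.
  split=> _; last exact: (reducing_shift_subnormal bS c0 S0 SS v_prod q0).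
  have -> : a0 / al ^+ 2 = 1 by rewrite alE a1z a01 addr0 expr1n divr1.
  by rewrite a1z mul0r; exact: hausdorff_defect_reducing.
have a1_gt0 : 0 < a1 by rewrite lt_neqAle eq_sym a1nz.
have [a0z|a0nz] := eqVneq a0 0.
  have al_a1 : al = a1 by rewrite alE a0z add0r.
  have e0 : 0 <= al - 1 by rewrite subr_ge0.
  have shift_E n : a1 / al ^+ 2 / (1 + n%:R * c) = (1 + n.+1%:R * (al - 1))^-1.
    rewrite -natr1 -al_a1 expr2 invfM mulrA divff ?gt_eqF// mul1r -invfM.
    congr (_^-1); move: rel; rewrite a0z subr0 mul1r -al_a1 => {}rel.
    by rewrite mulrDr mulr1 mulrCA rel; ring.
  split=> _; last first.
    pose v' n := if n is n'.+1 then dual_shift_weight w n' else w 1%N / al%:C%C.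
    apply: (@weighted_shift_subnormal _ _ v' (al - 1)) => //.
    - case=> [|n]; rewrite ?S0 ?SS//; move/eqP: a0z; rewrite sqmod_eq0 => /eqP ->.
      by rewrite mul0r scale0r add0r.
    - case=> [|n]; first by rewrite big_ord0 mul0r addr0 invr1.
      by rewrite big_ord_recl /= v_prod sqmod_q shift_E.
  by rewrite a0z mul0r; exact: (hausdorff_defect_shift e0 shift_E).
have a0_gt0 : 0 < a0 by rewrite lt_neqAle eq_sym a0nz.
have al2 : 0 < al ^+ 2 by rewrite exprn_gt0.
have [cz|cnz] := eqVneq c 0.
  have al_le : al <= al ^+ 2 by rewrite expr2 ler_peMl// ltW.
  have s1 : a0 / al ^+ 2 < 1 by rewrite ltr_pdivrMr// mul1r; lra.
  have Qs : a1 / al ^+ 2 <= 1 - a0 / al ^+ 2.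
    by rewrite lerBrDr -mulrDl ler_pdivrMr// mul1r; lra.
  split=> _; last first.
    by apply: (isometric_shift_subnormal bS c0 S0 SS v_prod cz); rewrite sqmod_p ?sqmod_q.
  rewrite cz; apply: hausdorff_defect_isometric.
    by rewrite divr_ge0// ltW.
  by rewrite divr_ge0// ltW.
have c_gt0 : 0 < c by rewrite lt_neqAle eq_sym cnz.
have nz (z : R[i]) : sqmod z != 0 -> z / al%:C%C != 0.
  by move=> z0; rewrite mulf_neq0 ?invr_eq0// -sqmod_eq0.
have support (f : l2_hilbert R) n : (f : l2 R) n = 0 ->
    (cauchy_dual (wco phi w) f : l2 R) n.+1 = 0.
  by move=> fn; rewrite (dual_coordinate phi0 phiS C_everywhere C_two_isometry) phiS fn mul0r mulr0.
split=> [sub|haus]; exfalso.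
  exact: (perturbed_shift_not_subnormal bS S0 SS support v_prod c_gt0 (nz _ a0nz) (nz _ a1nz) sub).
by apply: (defect_moment_not_hausdorff _ _ c_gt0 haus); rewrite divr_gt0.
Qed.
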